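(* Assume the setting and conditions (A1)–(A7) described in the context. Then the impulsive system (2) replicates the sensitivity of system (1) in the following sense. Suppose system (1) is sensitive: there exist $\epsilon_0>0$ and $\Delta>0$ such that for every $\delta_0>0$ and every $x\in\mathscr A$ there exist $\overline{x}\in\mathscr A$, $t_0\in\mathbb R$ and an interval $J\subset[t_0,\infty)$ of length at least $\Delta$ with $\|x(t_0)-\overline{x}(t_0)\|<\delta_0$ and $\|x(t)-\overline{x}(t)\|>\epsilon_0$ for all $t\in J$. Then there exist $\epsilon_1>0$ and $\overline{\Delta}>0$ such that for every $\delta_1>0$ and every $x\in\mathscr A$ there exist $\overline{x}\in\mathscr A$, $t_0\in\mathbb R$ and an interval $J^1\subset[t_0,\infty)$ of length at least $\overline{\Delta}$, containing at most one element of the sequence $\{\theta_k\}$, such that $$\|\phi_{x}(t_0)-\phi_{\overline{x}}(t_0)\|<\delta_1\quad\text{and}\quad \|\phi_{x}(t)-\phi_{\overline{x}}(t)\|>\epsilon_1 \text{ for all } t\in J^1.$$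
   Context: Norms are Euclidean for vectors and the induced operator norm for matrices. System (1): $x'=F(t,x)$, where $F:\mathbb R\times\mathbb R^m\to\mathbb R^m$ is continuous and $T$-periodic in $t$ ($T>0$). $\mathscr A$ denotes the (assumed nonempty) set of all solutions of (1) that are uniformly bounded on $\mathbb R$, and $\Lambda\subset\mathbb R^m$ is a compact set containing the trajectories of all elements of $\mathscr A$. System (2) (impulsive, driven by $x\in\mathscr A$): $y'=Ay+f(t,y)+g(x(t))$ for $t\neq\theta_k$, and $y(\theta_k+)-y(\theta_k)=By(\theta_k)+W(y(\theta_k))$, $k\in\mathbb Z$, where $f:\mathbb R\times\mathbb R^n\to\mathbb R^n$, $g:\mathbb R^m\to\mathbb R^n$, $W:\mathbb R^n\to\mathbb R^n$ are continuous, $f(t+T,y)=f(t,y)$, $A,B$ are real constant $n\times n$ matrices, $\{\theta_k\}_{k\in\mathbb Z}$ is strictly increasing with $\theta_{k+p}=\theta_k+T$ for some fixed $p\in\mathbb N$. Solutions are left-continuous, with first-kind discontinuities only at the $\theta_k$, satisfying the differential equation off $\{\theta_k\}$ (with left derivative at $\theta_k$) and the jump condition. $U(t,s)$ is the transition matrix of $u'=Au$ ($t\ne\theta_k$), $\Delta u|_{t=\theta_k}=Bu$. Conditions: (A1) $AB=BA$ and $\det(I+B)\neq0$. (A2) all eigenvalues of $A+\frac{p}{T}\ln(I+B)$ have negative real parts. Under (A1),(A2) there exist $N>0,\omega>0$ with $\|U(t,s)\|\le Ne^{-\omega(t-s)}$ for $t\ge s$; fix such $N,\omega$. (A3) $\sup_{t,y}\|f(t,y)\|\le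 M_f$, $\sup_y\|W(y)\|\le M_W$ for some positive $M_f,M_W$. (A4) there are positive $L_F,L_f,L_1,L_2,L_W$ with: $\|F(t,x_1)-F(t,x_2)\|\le L_F\|x_1-x_2\|$ for $t\in\mathbb R$, $x_1,x_2\in\Lambda$; $\|f(t,y_1)-f(t,y_2)\|\le L_f\|y_1-y_2\|$; $L_1\|x_1-x_2\|\le\|g(x_1)-g(x_2)\|\le L_2\|x_1-x_2\|$ for $x_1,x_2\in\Lambda$; $\|W(y_1)-W(y_2)\|\le L_W\|y_1-y_2\|$. (A5) $N\big(\frac{L_f}{\omega}+\frac{pL_W}{1-e^{-\omega T}}\big)<1$. (A6) $-\omega+NL_f+\frac pT\ln(1+NL_W)<0$. (A7) $L_W\|(I+B)^{-1}\|<1$. Under these conditions, for each $x\in\mathscr A$ system (2) has a unique solution $\phi_x$ bounded on $\mathbb R$; it satisfies $\phi_x(t)=\int_{-\infty}^tU(t,s)[f(s,\phi_x(s))+g(x(s))]ds+\sum_{\theta_k<t}U(t,\theta_k+)W(\phi_x(\theta_k))$. *)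

(* Defs.v *)
From mathcomp Require Import ssreflect ssrfun ssrbool eqtype ssrnat seq choice
  fintype bigop finfun fingroup perm.
From Stdlib Require Import Reals ZArith ClassicalEpsilon.
Set Implicit Arguments. Unset Strict Implicit.

Open Scope R_scope.

Definition vec (n : nat) := 'I_n -> R.
Definition mat (n : nat) := 'I_n -> 'I_n -> R.

Definition vadd n (u v : vec n) : vec n := fun i => u i + v i.
Definition vsub n (u v : vec n) : vec n := fun i => u i - v i.
Definition vscale n (c : R) (u : vec n) : vec n := fun i => c * u i.
Definition vzero n : vec n := fun _ => 0.

Definition vnorm n (v : vec n) : R :=
  sqrt (\big[Rplus/0]_(i < n) (v i * v i)).

Definition mv n (M : mat n) (v : vec n) : vec n :=
  fun i => \big[Rplus/0]_(j < n) (M i j * v j).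
Definition mmul n (M1 M2 : mat n) : mat n :=
  fun i j => \big[Rplus/0]_(k < n) (M1 i k * M2 k j).
Definition madd n (M1 M2 : mat n) : mat n := fun i j => M1 i j + M2 i j.
Definition msub n (M1 M2 : mat n) : mat n := fun i j => M1 i j - M2 i j.
Definition mscale n (c : R) (M : mat n) : mat n := fun i j => c * M i j.
Definition mid n : mat n := fun i j => if i == j then 1 else 0.
Definition mzero n : mat n := fun _ _ => 0.
Arguments mid : clear implicits.
Arguments mzero : clear implicits.
Arguments vzero : clear implicits.

Definition mdet n (M : mat n) : R :=
  \big[Rplus/0]_(s : {perm 'I_n})
     ((if odd_perm s then -1 else 1) * \big[Rmult/1]_(i < n) M i (s i)).

(* the inverse matrix (meaningful when it exists, i.e. det <> 0) *)
Definition minv n (M : mat n) : mat n :=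
  epsilon (inhabits (mzero n))
    (fun Q => mmul M Q = mid n /\ mmul Q M = mid n).

Definition opnorm_set n (M : mat n) : R -> Prop :=
  fun r => exists v : vec n, vnorm v <= 1 /\ r = vnorm (mv M v).
Definition opnorm n (M : mat n) : R :=
  epsilon (inhabits 0) (is_lub (opnorm_set M)).

(* ---------- complex matrices (as pairs real part / imaginary part) ---- *)
Definition cmat n := (mat n * mat n)%type.
Definition cmmul n (X Y : cmat n) : cmat n :=
  (msub (mmul X.1 Y.1) (mmul X.2 Y.2), madd (mmul X.1 Y.2) (mmul X.2 Y.1)).
Definition cmadd n (X Y : cmat n) : cmat n := (madd X.1 Y.1, madd X.2 Y.2).
Definition cmscale n (c : R) (X : cmat n) : cmat n := (mscale c X.1, mscale c X.2).
Definition cmid n : cmat n := (mid n, mzero n).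
Arguments cmid : clear implicits.
Definition cmofreal n (M : mat n) : cmat n := (M, mzero n).

Fixpoint cmpow n (X : cmat n) (k : nat) : cmat n :=
  match k with O => cmid n | S k' => cmmul X (cmpow X k') end.

Fixpoint cexp_partial n (X : cmat n) (k : nat) : cmat n :=
  match k with
  | O => cmid n
  | S k' => cmadd (cexp_partial X k') (cmscale (/ INR (fact (S k'))) (cmpow X (S k')))
  end.

Definition cexp_is n (X Y : cmat n) : Prop :=
  forall i j, Un_cv (fun k => (cexp_partial X k).1 i j) (Y.1 i j) /\
              Un_cv (fun k => (cexp_partial X k).2 i j) (Y.2 i j).

(* (a + i b) is an eigenvalue of the complex matrix X = P + i Q:
   exists nonzero x + i y with (P + iQ)(x + iy) = (a + ib)(x + iy) *)
Definition ceigen n (X : cmat n) (a b : R) : Prop :=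
  exists x y : vec n, (x <> vzero n \/ y <> vzero n) /\
    vsub (mv X.1 x) (mv X.2 y) = vsub (vscale a x) (vscale b y) /\
    vadd (mv X.2 x) (mv X.1 y) = vadd (vscale b x) (vscale a y).

(* (A2): all eigenvalues of A + (p/T) ln(I+B) have negative real parts,
   ln(I+B) being a (complex) logarithm of I+B commuting with A *)
Definition cond_A2 n (A B : mat n) (p : nat) (T : R) : Prop :=
  exists L : cmat n,
    cexp_is L (cmofreal (madd (mid n) B)) /\
    cmmul (cmofreal A) L = cmmul L (cmofreal A) /\
    (forall a b, ceigen (cmadd (cmofreal A) (cmscale (INR p / T) L)) a b -> a < 0).

Definition has_deriv n (y : R -> vec n) (t : R) (l : vec n) : Prop :=
  forall i, derivable_pt_lim (fun s => y s i) t (l i).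

Definition has_left_deriv n (y : R -> vec n) (t : R) (l : vec n) : Prop :=
  forall i eps, 0 < eps -> exists del, 0 < del /\
    forall h, - del < h < 0 -> Rabs ((y (t + h) i - y t i) / h - l i) < eps.

Definition left_cont n (y : R -> vec n) (t : R) : Prop :=
  forall i eps, 0 < eps -> exists del, 0 < del /\
    forall h, - del < h < 0 -> Rabs (y (t + h) i - y t i) < eps.

Definition right_lim n (y : R -> vec n) (t : R) (L : vec n) : Prop :=
  forall i eps, 0 < eps -> exists del, 0 < del /\
    forall h, 0 < h < del -> Rabs (y (t + h) i - L i) < eps.

Definition bounded_fun n (y : R -> vec n) : Prop :=
  exists M, forall t, vnorm (y t) <= M.

Definition vcont2 a b (G : R -> vec a -> vec b) : Prop :=
  forall t x eps, 0 < eps -> exists del, 0 < del /\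
    forall t' x', Rabs (t' - t) < del -> vnorm (vsub x' x) < del ->
      vnorm (vsub (G t' x') (G t x)) < eps.

Definition vcont1 a b (G : vec a -> vec b) : Prop :=
  forall x eps, 0 < eps -> exists del, 0 < del /\
    forall x', vnorm (vsub x' x) < del -> vnorm (vsub (G x') (G x)) < eps.

(* compact subset of R^m (Heine--Borel: closed and bounded) *)
Definition compact_set m (K : vec m -> Prop) : Prop :=
  (exists M, forall x, K x -> vnorm x <= M) /\
  (forall x, (forall eps, 0 < eps -> exists y, K y /\ vnorm (vsub y x) < eps) -> K x).

Definition ode_sol m (F : R -> vec m -> vec m) (x : R -> vec m) : Prop :=
  forall t, has_deriv x t (F t (x t)).

Definition inA m (F : R -> vec m -> vec m) (x : R -> vec m) : Prop :=
  ode_sol F x /\ bounded_fun x.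

(* solution on R of the impulsive system
     y' = A y + h(t,y)   (t <> theta_k),
     y(theta_k+) - y(theta_k) = B y(theta_k) + W (y(theta_k));
   left-continuous, discontinuities (of first kind) only at the theta_k,
   left derivative at theta_k *)
Definition imp_sol n (A B : mat n) (h : R -> vec n -> vec n) (W : vec n -> vec n)
    (theta : Z -> R) (y : R -> vec n) : Prop :=
  (forall t, left_cont y t) /\
  (forall t, (forall k, t <> theta k) -> has_deriv y t (vadd (mv A (y t)) (h t (y t)))) /\
  (forall k, has_left_deriv y (theta k)
               (vadd (mv A (y (theta k))) (h (theta k) (y (theta k))))) /\
  (forall k, right_lim y (theta k)
               (vadd (y (theta k)) (vadd (mv B (y (theta k))) (W (y (theta k)))))).

Definition transition_matrix n (A B : mat n) (theta : Z -> R) (U : R -> R -> mat n) : Prop :=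
  forall s (v : vec n),
    imp_sol A B (fun _ _ => vzero n) (fun _ => vzero n) theta (fun t => mv (U t s) v) /\
    mv (U s s) v = v.

Definition is_interval (J : R -> Prop) : Prop :=
  forall u v w, J u -> J w -> u <= v <= w -> J v.

(* length (sup J - inf J) is at least D *)
Definition length_ge (J : R -> Prop) (D : R) : Prop :=
  forall eta, 0 < eta -> exists u w, J u /\ J w /\ w - u > D - eta.

(* Main.v *)
(** Let [d] be the difference of the bounded responses to [x] and [xb]; it solves the linear
impulsive equation forced by the Lipschitz terms and by [g (x t) - g (xb t)].  For such
equations a comparison argument in the norm [sup_(r >= t) e^(omega (r-t)) |U(r,t) y|], in which
the linear flow is a contraction, shows with (A6) that past data are forgotten exponentially.
This bounds all [phi x] uniformly, and it makes [d t0] small as soon as [x] and [xb] are close on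
a long interval before [t0], which backward Gronwall deduces from closeness at [t0] alone.
Conversely, where [x] and [xb] stay [eps0] apart, [g (x t) - g (xb t)] has norm at least
[L_1 eps0] and, by equicontinuity, an almost constant direction on a short impulse-free
interval; [d] cannot stay small there, and being equi-Lipschitz there it stays large for a
uniform time.  The interval [J1] thus contains no impulse at all. *)

From HB Require Import structures.
From Coquelicot Require Import Coquelicot.
Require Import Defs.
From mathcomp Require Import ssreflect ssrfun ssrbool eqtype ssrnat seq fintype bigop.
From Stdlib Require Import Reals ZArith Lra Lia FunctionalExtensionality ClassicalEpsilon.
Open Scope R_scope.
Set Implicit Arguments. Unset Strict Implicit.

(** Gives real sums the commutative structure that [big_split] and [bigD1] require in [dotDl] and
    [coord_le]. *)
HB.instance Definition _ := Monoid.isComLaw.Build R 0 Rplus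
  (fun x y z => esym (Rplus_assoc x y z)) Rplus_comm Rplus_0_l.

(** * Inner product, Euclidean norm and matrices acting on vectors *)

Definition dot n (u v : vec n) : R := \big[Rplus/0]_(i < n) (u i * v i).

Ltac vec_ring :=
  apply: functional_extensionality => ?; rewrite /vadd /vsub /vscale /vzero; ring.

Lemma bigRplus_scale (I : Type) (r : seq I) (c : R) (G : I -> R) :
  \big[Rplus/0]_(i <- r) (c * G i) = c * \big[Rplus/0]_(i <- r) G i.
Proof.
elim: r => [|i r IH]; first by rewrite !big_nil Rmult_0_r.
by rewrite !big_cons IH Rmult_plus_distr_l.
Qed.

Lemma bigRplus_le (I : Type) (r : seq I) (G H : I -> R) :
  (forall i, G i <= H i) -> \big[Rplus/0]_(i <- r) G i <= \big[Rplus/0]_(i <- r) H i.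
Proof.
move=> GH; elim: r => [|i r IH]; first by rewrite !big_nil; lra.
by rewrite !big_cons; have := GH i; lra.
Qed.

Lemma bigRplus_ge0 (I : Type) (r : seq I) (G : I -> R) :
  (forall i, 0 <= G i) -> 0 <= \big[Rplus/0]_(i <- r) G i.
Proof.
move=> G0; elim: r => [|i r IH]; first by rewrite big_nil; lra.
by rewrite big_cons; have := G0 i; lra.
Qed.

Lemma bigRplus_const (n : nat) (c : R) : \big[Rplus/0]_(i < n) c = INR n * c.
Proof.
rewrite big_const card_ord; elim: n => [|n IH]; first by rewrite /= Rmult_0_l.
by rewrite iterS IH S_INR; ring.
Qed.

Lemma dotC n (u v : vec n) : dot u v = dot v u.
Proof. by apply: eq_bigr => i _; rewrite Rmult_comm. Qed.

Lemma dotDl n (u v w : vec n) : dot (vadd u v) w = dot u w + dot v w.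
Proof. by rewrite /dot -big_split; apply: eq_bigr => i _; rewrite /vadd /=; ring. Qed.

Lemma dotZl n c (u w : vec n) : dot (vscale c u) w = c * dot u w.
Proof. by rewrite /dot -bigRplus_scale; apply: eq_bigr => i _; rewrite /vscale; ring. Qed.

Lemma vsubE n (u v : vec n) : vsub u v = vadd u (vscale (-1) v).
Proof. vec_ring. Qed.

Lemma dotBl n (u v w : vec n) : dot (vsub u v) w = dot u w - dot v w.
Proof. by rewrite vsubE dotDl dotZl; ring. Qed.

Lemma dot_ge0 n (v : vec n) : 0 <= dot v v.
Proof. by apply: bigRplus_ge0 => i; nra. Qed.

Lemma vnorm_ge0 n (v : vec n) : 0 <= vnorm v.
Proof. exact: sqrt_pos. Qed.

Lemma vnorm_sqr n (v : vec n) : vnorm v * vnorm v = dot v v.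
Proof. exact: sqrt_sqrt (dot_ge0 v). Qed.

Lemma coord_le n (v : vec n) i : Rabs (v i) <= vnorm v.
Proof.
apply: Rsqr_incr_0; [|exact: Rabs_pos|exact: vnorm_ge0].
rewrite -Rsqr_abs /Rsqr vnorm_sqr /dot (bigD1 i) //=.
rewrite -{1}[v i * v i]Rplus_0_r; apply: Rplus_le_compat_l.
by rewrite big_mkcond; apply: bigRplus_ge0 => j; case: ifP => _; nra.
Qed.

Lemma vnorm_eq0 n (v : vec n) : vnorm v <= 0 -> v = vzero n.
Proof.
move=> v0; apply: functional_extensionality => i.
have := coord_le v i; rewrite /vzero; split_Rabs; lra.
Qed.

(** Cauchy-Schwarz. The factor [s] makes [vscale s v] as long as [u], so expanding the square of
    [vsub u (vscale s v)] bounds [s * dot u v] by the square of [vnorm u], and one divides by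
    [s]. *)
Lemma dot_le n (u v : vec n) : dot u v <= vnorm u * vnorm v.
Proof.
case: (Rle_or_lt (vnorm v) 0) => [/vnorm_eq0 ->|v0].
  rewrite dotC (_ : vzero n = vscale 0 (vzero n)); last by vec_ring.
  by rewrite dotZl Rmult_0_l; apply: Rmult_le_pos; apply: vnorm_ge0.
set s := vnorm u / vnorm v.
have := dot_ge0 (vsub u (vscale s v)).
rewrite dotBl !(dotC _ (vsub _ _)) !dotBl dotZl (dotC u (vscale _ _)) !dotZl (dotC v (vscale _ _)) dotZl.
rewrite (dotC v u) -!vnorm_sqr => H.
have su : s * vnorm v = vnorm u by rewrite /s; field; lra.
have H2 : 2 * s * dot u v <= 2 * (vnorm u * vnorm u).
  have : s * (s * (vnorm v * vnorm v)) = vnorm u * vnorm u by rewrite -su; ring.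
  move: H; lra.
case: (Rle_or_lt (vnorm u) 0) => [u0|u0].
  rewrite (vnorm_eq0 u0) (_ : vzero n = vscale 0 (vzero n)); last by vec_ring.
  by rewrite dotZl Rmult_0_l; apply: Rmult_le_pos; apply: vnorm_ge0.
have s0 : 0 < s by apply: Rdiv_lt_0_compat.
apply: (Rmult_le_reg_l s) => //.
have : s * (vnorm u * vnorm v) = vnorm u * vnorm u by rewrite -{3}su; ring.
lra.
Qed.

Lemma vnorm_le_sqr n (v : vec n) c : 0 <= c -> dot v v <= c * c -> vnorm v <= c.
Proof. by move=> c0 H; apply: Rsqr_incr_0 => //; [rewrite /Rsqr vnorm_sqr|apply: vnorm_ge0]. Qed.

Lemma vnorm_add n (u v : vec n) : vnorm (vadd u v) <= vnorm u + vnorm v.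
Proof.
have := vnorm_ge0 u; have := vnorm_ge0 v => v0 u0.
apply: vnorm_le_sqr; first lra.
rewrite dotDl !(dotC _ (vadd _ _)) !dotDl -!vnorm_sqr (dotC v u).
have := dot_le u v; lra.
Qed.

Lemma vnormZ n c (v : vec n) : vnorm (vscale c v) = Rabs c * vnorm v.
Proof.
have c0 := Rabs_pos c; have v0 := vnorm_ge0 v.
apply: Rsqr_inj; [exact: vnorm_ge0|exact: Rmult_le_pos|].
rewrite Rsqr_mult -Rsqr_abs /Rsqr !vnorm_sqr dotZl dotC dotZl; ring.
Qed.

Lemma vnorm_sub n (u v : vec n) : vnorm (vsub u v) <= vnorm u + vnorm v.
Proof.
rewrite vsubE; have := vnorm_add u (vscale (-1) v).
by rewrite vnormZ Rabs_Ropp Rabs_R1 Rmult_1_l.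
Qed.

Lemma vnorm_subC n (u v : vec n) : vnorm (vsub u v) = vnorm (vsub v u).
Proof.
rewrite (_ : vsub u v = vscale (-1) (vsub v u)); last by vec_ring.
by rewrite vnormZ Rabs_Ropp Rabs_R1 Rmult_1_l.
Qed.

Lemma vnorm_le_sub n (u v : vec n) : vnorm u <= vnorm v + vnorm (vsub u v).
Proof.
rewrite {1}(_ : u = vadd v (vsub u v)); first exact: vnorm_add.
vec_ring.
Qed.

Lemma vnorm0 n : vnorm (vzero n) = 0.
Proof.
rewrite (_ : vzero n = vscale 0 (vzero n)); last by vec_ring.
by rewrite vnormZ Rabs_R0 Rmult_0_l.
Qed.

Lemma vnorm_coords n (v : vec n) e :
  0 <= e -> (forall i, Rabs (v i) <= e) -> vnorm v <= INR n * e.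
Proof.
move=> e0 H; have n0 := pos_INR n.
apply: vnorm_le_sqr; first exact: Rmult_le_pos.
apply: (Rle_trans _ (INR n * (e * e))).
  rewrite -bigRplus_const; apply: bigRplus_le => i; have := H i.
  split_Rabs; nra.
case: n n0 {v H} => [|n] n0; first by rewrite /=; lra.
have : 1 <= INR n.+1 by rewrite S_INR; have := pos_INR n; lra.
by move=> n1; have : 0 <= e * e by [nra]; nra.
Qed.

Lemma mvE n (M : mat n) v i : mv M v i = dot (M i) v.
Proof. by []. Qed.

Lemma mvD n (M : mat n) u v : mv M (vadd u v) = vadd (mv M u) (mv M v).
Proof.
apply: functional_extensionality => i.
by rewrite /vadd !mvE dotC dotDl !(dotC (M i)).
Qed.

Lemma mvZ n (M : mat n) c v : mv M (vscale c v) = vscale c (mv M v).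
Proof.
apply: functional_extensionality => i.
by rewrite /vscale !mvE dotC dotZl !(dotC (M i)).
Qed.

Lemma mvB n (M : mat n) u v : mv M (vsub u v) = vsub (mv M u) (mv M v).
Proof. by rewrite !vsubE mvD mvZ. Qed.

Lemma mv0 n (M : mat n) : mv M (vzero n) = vzero n.
Proof.
rewrite (_ : vzero n = vscale 0 (vzero n)); last by vec_ring.
by rewrite mvZ; vec_ring.
Qed.

(** The constant is the Frobenius norm, by Cauchy-Schwarz on each row. It shows that [opnorm_set] is
    bounded above. *)
Lemma mv_bound n (M : mat n) : exists2 a, 0 <= a & forall v, vnorm (mv M v) <= a * vnorm v.
Proof.
set S := \big[Rplus/0]_(i < n) dot (M i) (M i).
have S0 : 0 <= S by apply: bigRplus_ge0 => i; apply: dot_ge0.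
exists (sqrt S) => [|v]; first exact: sqrt_pos.
have v0 := vnorm_ge0 v; have q0 := sqrt_pos S.
apply: vnorm_le_sqr; first exact: Rmult_le_pos.
have -> : sqrt S * vnorm v * (sqrt S * vnorm v) = dot v v * S.
  by rewrite -{3}(sqrt_sqrt S S0) -vnorm_sqr; ring.
rewrite /S -bigRplus_scale; apply: bigRplus_le => i; rewrite mvE -!vnorm_sqr.
have H1 := dot_le (M i) v.
have H2 : - dot (M i) v <= vnorm (M i) * vnorm v.
  have := dot_le (vscale (-1) (M i)) v.
  by rewrite dotZl vnormZ Rabs_Ropp Rabs_R1; lra.
have m0 := vnorm_ge0 (M i).
have -> : vnorm v * vnorm v * (vnorm (M i) * vnorm (M i)) =
          (vnorm (M i) * vnorm v) * (vnorm (M i) * vnorm v) by ring.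
nra.
Qed.

Lemma opnorm_bound n (M : mat n) v : vnorm (mv M v) <= opnorm M * vnorm v.
Proof.
have [a a0 Ha] := mv_bound M.
(* [opnorm] is an [epsilon] choice, so a least upper bound must first be shown to exist. *)
have lub : is_lub (opnorm_set M) (opnorm M).
  apply: epsilon_spec.
  have [||l Hl] := @completeness (opnorm_set M); last by exists l.
  - exists a => r [u [u1 ->]]; have := Ha u; have := vnorm_ge0 u; nra.
  - exists 0; exists (vzero n); rewrite mv0 vnorm0; split => //; lra.
case: (Rle_or_lt (vnorm v) 0) => [/vnorm_eq0 ->|v0].
  by rewrite mv0 vnorm0; lra.
have : vnorm (mv M (vscale (/ vnorm v) v)) <= opnorm M.
  apply: (proj1 lub); exists (vscale (/ vnorm v) v); split => //.
  rewrite vnormZ Rabs_pos_eq; last by apply: Rlt_le; apply: Rinv_0_lt_compat.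
  by rewrite Rinv_l; lra.
rewrite mvZ vnormZ Rabs_pos_eq; last by apply: Rlt_le; apply: Rinv_0_lt_compat.
move=> H; apply: (Rmult_le_reg_l (/ vnorm v)); first exact: Rinv_0_lt_compat.
have -> : / vnorm v * (opnorm M * vnorm v) = opnorm M by field; lra.
exact: H.
Qed.

(** * Calculus of vector functions *)

Lemma derivable_pt_lim_bigsum (I : Type) (r : seq I) (G : I -> R -> R) (l : I -> R) t :
  (forall i, derivable_pt_lim (G i) t (l i)) ->
  derivable_pt_lim (fun s => \big[Rplus/0]_(i <- r) G i s) t (\big[Rplus/0]_(i <- r) l i).
Proof.
move=> H; elim: r => [|i r IH].
  rewrite big_nil (_ : (fun s => _) = fct_cte 0); first exact: derivable_pt_lim_const.
  by apply: functional_extensionality => s; rewrite big_nil.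
rewrite big_cons (_ : (fun s => _) = (G i + (fun s => \big[Rplus/0]_(i <- r) G i s))%F).
  exact: derivable_pt_lim_plus.
by apply: functional_extensionality => s; rewrite big_cons.
Qed.

Lemma has_deriv_dot n (y : R -> vec n) t l e :
  has_deriv y t l -> derivable_pt_lim (fun s => dot (y s) e) t (dot l e).
Proof.
move=> H; apply: (@derivable_pt_lim_bigsum _ _ (fun i s => y s i * e i)) => i.
rewrite (_ : (fun s => _) = ((fun s => y s i) * fct_cte (e i))%F) //.
have -> : l i * e i = l i * fct_cte (e i) t + y t i * 0 by rewrite /fct_cte; ring.
by apply: derivable_pt_lim_mult; [exact: H|exact: derivable_pt_lim_const].
Qed.

Lemma has_deriv_sq n (y : R -> vec n) t l :
  has_deriv y t l -> derivable_pt_lim (fun s => dot (y s) (y s)) t (2 * dot l (y t)).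
Proof.
move=> H; rewrite /dot -bigRplus_scale.
apply: (@derivable_pt_lim_bigsum _ _ (fun i s => y s i * y s i)) => i.
rewrite (_ : (fun s => _) = ((fun s => y s i) * (fun s => y s i))%F) //.
have -> : 2 * (l i * y t i) = l i * y t i + y t i * l i by ring.
by apply: derivable_pt_lim_mult; exact: H.
Qed.

Lemma has_deriv_sub n (y z : R -> vec n) t l k :
  has_deriv y t l -> has_deriv z t k -> has_deriv (fun s => vsub (y s) (z s)) t (vsub l k).
Proof. by move=> Hy Hz i; exact: derivable_pt_lim_minus (Hy i) (Hz i). Qed.

Lemma left_cont_sub n (y z : R -> vec n) t :
  left_cont y t -> left_cont z t -> left_cont (fun s => vsub (y s) (z s)) t.
Proof.
move=> Hy Hz i e e0.
have [d1 [d10 H1]] := Hy i (e / 2) ltac:(lra).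
have [d2 [d20 H2]] := Hz i (e / 2) ltac:(lra).
exists (Rmin d1 d2); split; first exact: Rmin_pos.
move=> h Hh; have m1 := Rmin_l d1 d2; have m2 := Rmin_r d1 d2.
have := H1 h ltac:(lra); have := H2 h ltac:(lra); rewrite /vsub; split_Rabs; lra.
Qed.

Lemma right_lim_sub n (y z : R -> vec n) t l k :
  right_lim y t l -> right_lim z t k -> right_lim (fun s => vsub (y s) (z s)) t (vsub l k).
Proof.
move=> Hy Hz i e e0.
have [d1 [d10 H1]] := Hy i (e / 2) ltac:(lra).
have [d2 [d20 H2]] := Hz i (e / 2) ltac:(lra).
exists (Rmin d1 d2); split; first exact: Rmin_pos.
move=> h Hh; have m1 := Rmin_l d1 d2; have m2 := Rmin_r d1 d2.
have := H1 h ltac:(lra); have := H2 h ltac:(lra); rewrite /vsub; split_Rabs; lra.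
Qed.

(** Limits and derivatives are defined coordinate by coordinate; the minimum of finitely many radii
    makes them uniform, which leads to estimates in norm. *)
Lemma coords_uniform n (P : 'I_n -> R -> Prop) :
  (forall i, exists d, 0 < d /\ forall h, Rabs h < d -> P i h) ->
  exists2 d, 0 < d & forall h, Rabs h < d -> forall i, P i h.
Proof.
move=> H.
suff [d d0 Hd] : exists2 d, 0 < d & forall h, Rabs h < d -> forall i, i \in enum 'I_n -> P i h.
  by exists d => // h hd i; apply: Hd => //; rewrite mem_enum.
elim: (enum 'I_n) => [|i s [d d0 IH]]; first by exists 1 => //; lra.
have [e [e0 He]] := H i.
exists (Rmin d e) => [|h Hh j]; first exact: Rmin_pos.
have m1 := Rmin_l d e; have m2 := Rmin_r d e.
rewrite inE => /orP[/eqP ->|js]; first by apply: He; lra.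
by apply: IH => //; lra.
Qed.

Lemma coord_eps n e : 0 < e -> exists2 e', 0 < e' & INR n * e' <= e.
Proof.
move=> e0; have n0 := pos_INR n.
(* The [+ 1] covers dimension zero. *)
exists (e / (INR n + 1)); first by apply: Rdiv_lt_0_compat; lra.
rewrite -[X in _ <= X]Rmult_1_r /Rdiv (Rmult_comm e) -Rmult_assoc Rmult_comm.
apply: Rmult_le_compat_l; first lra.
apply: (Rmult_le_reg_r (INR n + 1)); first lra.
by rewrite Rmult_assoc Rinv_l; lra.
Qed.

Lemma left_cont_norm n (y : R -> vec n) t e : left_cont y t -> 0 < e ->
  exists2 d, 0 < d & forall h, 0 < h < d -> vnorm (vsub (y t) (y (t - h))) <= e.
Proof.
move=> H /(coord_eps n)[e' e'0 le_e].
have [i|d d0 Hd] := @coords_uniform n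
  (fun i h => h < 0 -> Rabs (y (t + h) i - y t i) < e').
  have [d [d0 Hd]] := H i e' e'0; exists d; split => // h hd h0.
  by apply: Hd; split_Rabs; lra.
exists d => // h Hh; apply: Rle_trans le_e.
apply: vnorm_coords => [|i]; first lra.
have := Hd (- h) ltac:(split_Rabs; lra) i ltac:(lra); rewrite /vsub /Rminus.
split_Rabs; lra.
Qed.

Lemma right_lim_norm n (y : R -> vec n) t l e : right_lim y t l -> 0 < e ->
  exists2 d, 0 < d & forall h, 0 < h < d -> vnorm (vsub (y (t + h)) l) <= e.
Proof.
move=> H /(coord_eps n)[e' e'0 le_e].
have [i|d d0 Hd] := @coords_uniform n
  (fun i h => 0 < h -> Rabs (y (t + h) i - l i) < e').
  have [d [d0 Hd]] := H i e' e'0; exists d; split => // h hd h0.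
  by apply: Hd; split_Rabs; lra.
exists d => // h Hh; apply: Rle_trans le_e.
apply: vnorm_coords => [|i]; first lra.
by apply: Rlt_le; apply: Hd; [split_Rabs; lra|lra].
Qed.

Lemma has_deriv_norm n (y : R -> vec n) t l e : has_deriv y t l -> 0 < e ->
  exists2 d, 0 < d & forall h, 0 < h < d ->
    vnorm (vsub (vsub (y (t + h)) (y t)) (vscale h l)) <= h * e.
Proof.
move=> H /(coord_eps n)[e' e'0 le_e].
have [i|d d0 Hd] := @coords_uniform n
  (fun i h => h <> 0 -> Rabs ((y (t + h) i - y t i) / h - l i) < e').
  have [d Hd] := H i e' e'0; exists d; split => [|h hd h0]; first exact: cond_pos.
  exact: Hd.
exists d => // h Hh.
apply: (Rle_trans _ (INR n * (h * e'))); last by nra.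
apply: vnorm_coords => [|i]; first by nra.
have := Hd h ltac:(split_Rabs; lra) i (Rgt_not_eq h 0 (proj1 Hh)).
have -> : vsub (vsub (y (t + h)) (y t)) (vscale h l) i =
          h * ((y (t + h) i - y t i) / h - l i).
  by rewrite /vsub /vscale; field; lra.
by rewrite Rabs_mult (Rabs_pos_eq h) => *; nra.
Qed.

Lemma has_deriv_right_lim n (y : R -> vec n) t l : has_deriv y t l -> right_lim y t (y t).
Proof.
move=> H i e e0.
have c : continuity_pt (fun s => y s i) t.
  by apply: derivable_continuous_pt; exists (l i); exact: H.
have [d [d0 Hd]] := c e e0; exists d; split => // h Hh.
apply: Hd; split; first by split => //; lra.
by rewrite /= /R_dist; split_Rabs; lra.
Qed.

(* The mean value theorem is applied to the projection of [v] on [v b - v a]. *)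
Lemma lipschitz_closed n (v l : R -> vec n) D a b : a <= b ->
  (forall t, a <= t <= b -> has_deriv v t (l t) /\ vnorm (l t) <= D) ->
  vnorm (vsub (v b) (v a)) <= D * (b - a).
Proof.
move=> [ab|->] H; last first.
  rewrite (_ : vsub _ _ = vzero n); last by vec_ring.
  by rewrite vnorm0; lra.
set e := vsub (v b) (v a).
have [c Hc|c [Hc c_ab]] := @MVT_cor2 (fun s => dot (v s) e) (fun s => dot (l s) e) a b ab.
  by apply: has_deriv_dot; apply: (H c Hc).1.
move: Hc; rewrite -dotBl -/e -vnorm_sqr => Hc.
have [_ lD] := H c ltac:(lra).
have le := dot_le (l c) e; have e0 := vnorm_ge0 e.
case: (Rle_or_lt (vnorm e) 0) => [?|epos].
  have := vnorm_ge0 (l c); nra.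
apply: (Rmult_le_reg_l (vnorm e)) => //; rewrite Hc.
have : dot (l c) e <= D * vnorm e by nra.
by nra.
Qed.

(** The right end may be an impulse time, where only left continuity is available; the closed
    version is used up to [b - h] with [h] small. *)
Lemma lipschitz_left n (v l : R -> vec n) D a b : a < b ->
  (forall t, a <= t < b -> has_deriv v t (l t) /\ vnorm (l t) <= D) ->
  left_cont v b ->
  vnorm (vsub (v b) (v a)) <= D * (b - a).
Proof.
move=> ab H Hb.
have D0 : 0 <= D by have [_] := H a ltac:(lra); have := vnorm_ge0 (l a); lra.
apply: le_epsilon => e e0.
have [d d0 Hd] := left_cont_norm Hb e0.
set h := Rmin (d / 2) (b - a).
have h0 : 0 < h by apply: Rmin_pos; lra.
have h1 : h <= d / 2 by apply: Rmin_l.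
have h2 : h <= b - a by apply: Rmin_r.
have := Hd h ltac:(lra).
have : vnorm (vsub (v (b - h)) (v a)) <= D * (b - h - a).
  by apply: (@lipschitz_closed _ v l) => [|t Ht]; [lra|apply: H; lra].
have := vnorm_add (vsub (v b) (v (b - h))) (vsub (v (b - h)) (v a)).
rewrite (_ : vadd _ _ = vsub (v b) (v a)); last by vec_ring.
nra.
Qed.

(** The norm itself is not differentiable at zero, so squares are used: [exp (-2 L t) |v t|^2] does
    not increase and [exp (2 L t) |v t|^2] does not decrease. The second bound runs backward in
    time. *)
Lemma gronwall n (v l : R -> vec n) L a b : a <= b ->
  (forall t, a <= t <= b -> has_deriv v t (l t) /\ vnorm (l t) <= L * vnorm (v t)) ->
  vnorm (v b) <= vnorm (v a) * exp (L * (b - a)) /\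
  vnorm (v a) <= vnorm (v b) * exp (L * (b - a)).
Proof.
move=> ab H.
have d t : a <= t <= b -> Rabs (dot (l t) (v t)) <= L * dot (v t) (v t).
  move=> Ht; have [_ HL] := H t Ht.
  have := dot_le (l t) (v t); have := dot_le (vscale (-1) (l t)) (v t).
  rewrite dotZl vnormZ Rabs_Ropp Rabs_R1 Rmult_1_l -vnorm_sqr.
  have := vnorm_ge0 (v t); split_Rabs; nra.
(* The mean value theorem for [exp (c t) |v t|^2], applied below with [c = -2 L] and [c = 2 L]. *)
have key c : exists2 t, a <= t <= b &
    exp (c * b) * dot (v b) (v b) - exp (c * a) * dot (v a) (v a) =
    exp (c * t) * (c * dot (v t) (v t) + 2 * dot (l t) (v t)) * (b - a).
  case: ab H d => [ab|->] H d; last by exists b; [lra|ring].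
  have [t Ht|t [-> Ht]] := @MVT_cor2 (fun s => exp (c * s) * dot (v s) (v s))
    (fun t => exp (c * t) * (c * dot (v t) (v t) + 2 * dot (l t) (v t))) a b ab; last first.
    by exists t; [lra|].
  have -> : exp (c * t) * (c * dot (v t) (v t) + 2 * dot (l t) (v t)) =
    c * exp (c * t) * dot (v t) (v t) + exp (c * t) * (2 * dot (l t) (v t)) by ring.
  apply: (derivable_pt_lim_mult (fun s => exp (c * s)) (fun s => dot (v s) (v s))).
    by apply/is_derive_Reals; auto_derive => //; ring.
  by apply: has_deriv_sq; apply: (H t Ht).1.
have fin c u w : 0 <= u -> 0 <= w -> 0 <= c ->
    exp (- (2 * L * c)) * (u * u) <= w * w -> u <= w * exp (L * c).
  move=> u0 w0 c0 Huw.
  have E := exp_pos (L * c).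
  apply: Rsqr_incr_0; [|done|by nra].
  have -> : Rsqr (w * exp (L * c)) = w * w * exp (2 * L * c).
    by rewrite (_ : 2 * L * c = L * c + L * c) ?exp_plus /Rsqr; ring.
  rewrite /Rsqr; apply: (Rmult_le_reg_l (exp (- (2 * L * c)))); first exact: exp_pos.
  apply: (Rle_trans _ _ _ Huw); rewrite Rmult_comm Rmult_assoc -exp_plus.
  by rewrite Rplus_opp_r exp_0; lra.
have hi := vnorm_ge0; split.
  have [t Ht Et] := key (- (2 * L)).
  apply: fin => //; first lra.
  rewrite !vnorm_sqr; apply: (Rmult_le_reg_l (exp (- (2 * L) * a))); first exact: exp_pos.
  rewrite -Rmult_assoc -exp_plus.
  have -> : - (2 * L) * a + - (2 * L * (b - a)) = - (2 * L) * b by ring.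
  have := exp_pos (- (2 * L) * t); have := d t Ht => Hd Ep.
  have : - (2 * L) * dot (v t) (v t) + 2 * dot (l t) (v t) <= 0 by split_Rabs; lra.
  move=> neg; have : exp (- (2 * L) * t) * (- (2 * L) * dot (v t) (v t) + 2 * dot (l t) (v t)) <= 0 by nra.
  by move=> neg2; nra.
have [t Ht Et] := key (2 * L).
apply: fin => //; first lra.
rewrite !vnorm_sqr; apply: (Rmult_le_reg_l (exp (2 * L * b))); first exact: exp_pos.
rewrite -Rmult_assoc -exp_plus.
have -> : 2 * L * b + - (2 * L * (b - a)) = 2 * L * a by ring.
have := exp_pos (2 * L * t); have := d t Ht => Hd Ep.
have : 0 <= 2 * L * dot (v t) (v t) + 2 * dot (l t) (v t) by split_Rabs; lra.
move=> pos; have : 0 <= exp (2 * L * t) * (2 * L * dot (v t) (v t) + 2 * dot (l t) (v t)) by nra.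
by move=> pos2; nra.
Qed.

(** Let [c] be the supremum of the points up to which [P] holds throughout. The left condition gives
    [P c], and the right condition would pass beyond [c] if [c < b]. Bounds are carried across
    impulses in this way, without iterating over the impulses. *)
Lemma real_induction (P : R -> Prop) a b : a <= b -> P a ->
  (forall t, a <= t < b -> P t -> exists2 d, 0 < d & forall h, 0 < h < d -> P (t + h)) ->
  (forall t, a < t <= b -> (forall r, a <= r < t -> P r) -> P t) ->
  P b.
Proof.
move=> ab Pa Hright Hleft.
pose E x := a <= x <= b /\ forall r, a <= r <= x -> P r.
have Ea : E a by split=> [|r Hr]; [lra|rewrite (_ : r = a) //; lra].
have [||c [ubc lubc]] := @completeness E.
- by exists b => x [Hx _]; lra.
- by exists a.
have ac : a <= c by apply: ubc.
have cb : c <= b by apply: lubc => x [Hx _]; lra.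
have below r : a <= r < c -> P r.
  move=> Hr; apply: NNPP => nP.
  have : c <= r; last by lra.
  apply: lubc => x [Hx Px]; apply: Rnot_lt_le => rx; apply: nP; apply: Px; lra.
have Pc : P c by case: ac => [ac|<-] //; apply: Hleft => //; lra.
case: cb => [cb|<-] //.
have [d d0 Hd] := Hright c ltac:(lra) Pc.
set h := Rmin (d / 2) (b - c).
have h0 : 0 < h by apply: Rmin_pos; lra.
have h1 : h <= d / 2 by apply: Rmin_l.
have h2 : h <= b - c by apply: Rmin_r.
have : c + h <= c; last by lra.
apply: ubc; split=> [|r Hr]; first lra.
case: (Rtotal_order r c) => [rc|[->|rc]] //; first by apply: below; lra.
have -> : r = c + (r - c) by ring.
apply: Hd; lra.
Qed.

(** * The impulse times *)

Section ImpulseTimes.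

Variables (theta : Z -> R) (T : R) (p : nat).
Hypotheses (T_gt0 : 0 < T) (p_gt0 : (0 < p)%nat).
Hypothesis theta_lt : forall k1 k2, (k1 < k2)%Z -> theta k1 < theta k2.
Hypothesis theta_per : forall k, theta (k + Z.of_nat p)%Z = theta k + T.

Lemma theta_le k1 k2 : (k1 <= k2)%Z -> theta k1 <= theta k2.
Proof.
by move=> /Z.le_lteq[/theta_lt|->]; lra.
Qed.

Lemma theta_shift k j : theta (k + j * Z.of_nat p)%Z = theta k + IZR j * T.
Proof.
have pos i l : theta (l + Z.of_nat i * Z.of_nat p)%Z = theta l + INR i * T.
  elim: i => [|i IH]; first by rewrite /= Z.add_0_r; ring.
  rewrite (_ : (l + _)%Z = (l + Z.of_nat i * Z.of_nat p + Z.of_nat p)%Z); last by lia.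
  by rewrite theta_per IH S_INR; ring.
case: (Z_le_gt_dec 0 j) => Hj.
  by rewrite -(Z2Nat.id j) // pos INR_IZR_INZ.
have := pos (Z.to_nat (- j)) (k + j * Z.of_nat p)%Z.
rewrite INR_IZR_INZ Z2Nat.id; last by lia.
rewrite (_ : (k + j * _ + _)%Z = k); last by lia.
by move=> ->; rewrite opp_IZR; ring.
Qed.

(** Open on the left and closed on the right, matching left continuity: an impulse time belongs to
    the interval that it ends. *)
Definition between_impulses k t := theta k < t <= theta (k + 1)%Z.

Lemma between_impulses_exists t : exists k, between_impulses k t.
Proof.
have [u1 _] := archimed ((theta 0 - t) / T).
have [u2 _] := archimed ((t - theta 0) / T).
set j1 := up _ in u1; set j2 := up _ in u2.
have lo : theta (0 + (- j1) * Z.of_nat p)%Z < t.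
  rewrite theta_shift opp_IZR.
  have := Rmult_gt_compat_r T _ _ T_gt0 u1.
  by rewrite /Rdiv Rmult_assoc Rinv_l; lra.
have hi : t <= theta (0 + j2 * Z.of_nat p)%Z.
  rewrite theta_shift.
  have := Rmult_gt_compat_r T _ _ T_gt0 u2.
  by rewrite /Rdiv Rmult_assoc Rinv_l; lra.
move: (0 + - j1 * _)%Z (0 + j2 * _)%Z lo hi => k1 k2 lo hi.
have k12 : (k1 < k2)%Z.
  by apply: Znot_ge_lt => /Z.ge_le /theta_le; lra.
(* Whole periods have placed [t] between two impulses; induction on the number of indices between
   them raises the lower one until the next impulse reaches [t]. *)
have Ek : k2 = (k1 + Z.of_nat (Z.to_nat (k2 - k1)))%Z by rewrite Z2Nat.id; lia.
move: (Z.to_nat _) Ek hi => i -> {k12}.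
elim: i k1 lo => [|i IH] k1 lo hi; first by move: hi; rewrite /= Z.add_0_r; lra.
case: (Rlt_le_dec (theta (k1 + 1)%Z) t) => H; last by exists k1.
apply: (IH _ H); rewrite (_ : (k1 + 1 + _)%Z = (k1 + Z.of_nat i.+1)%Z) //; lia.
Qed.

Definition idx t := epsilon (inhabits 0%Z) (fun k => between_impulses k t).

Lemma idxP t : theta (idx t) < t <= theta (idx t + 1)%Z.
Proof. exact: epsilon_spec (between_impulses_exists t). Qed.

Lemma idx_unique k t : theta k < t <= theta (k + 1)%Z -> idx t = k.
Proof.
move=> Hk; have Hi := idxP t.
have : ~ (idx t + 1 <= k)%Z by move=> /theta_le; lra.
have : ~ (k + 1 <= idx t)%Z by move=> /theta_le; lra.
lia.
Qed.

Lemma idx_theta k : idx (theta k) = (k - 1)%Z.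
Proof.
apply: idx_unique; rewrite Z.sub_add; split; last lra.
apply: theta_lt; lia.
Qed.

Lemma not_impulse k t : theta k < t < theta (k + 1)%Z -> forall j, t <> theta j.
Proof.
move=> Hk j Ej; have Hik : idx t = k by apply: idx_unique; lra.
have := idx_theta j; rewrite -Ej Hik => Ek.
by move: Hk; rewrite Ek Z.sub_add; lra.
Qed.

Lemma idx_left t h : 0 <= h < t - theta (idx t) -> idx (t - h) = idx t.
Proof. by move=> Hh; apply: idx_unique; have := idxP t; lra. Qed.

Lemma idx_right t : (forall k, t <> theta k) ->
  exists2 d, 0 < d & forall h, 0 < h < d -> idx (t + h) = idx t.
Proof.
move=> Ht; have Hi := idxP t; have H1 := Ht (idx t + 1)%Z.
exists (theta (idx t + 1)%Z - t) => [|h Hh]; last by apply: idx_unique; lra.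
by case: Hi => _ [|/H1]; lra.
Qed.

Lemma idx_right_theta k :
  exists2 d, 0 < d & forall h, 0 < h < d -> idx (theta k + h) = k.
Proof.
exists (theta (k + 1)%Z - theta k) => [|h Hh]; last by apply: idx_unique; lra.
by have := @theta_lt k (k + 1)%Z ltac:(lia); lra.
Qed.

Lemma p_real_gt0 : 0 < INR p.
Proof. by apply: lt_0_INR; apply/ltP. Qed.

(** Impulses have mean density [p / T]. Division of the index by [p] reduces the deviation to a
    single period. *)
Lemma idx_bound : exists2 C, 0 <= C & forall t, Rabs (IZR (idx t) - INR p / T * t) <= C.
Proof.
have p0 := p_real_gt0; have pT0 : 0 < INR p / T by apply: Rdiv_lt_0_compat.
have pz : (0 < Z.of_nat p)%Z by have := p_gt0; move/ltP; lia.
have step k : Rabs (IZR k - INR p / T * (theta k - theta 0)) <= INR p.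
  have Ek := Z.div_mod k (Z.of_nat p) ltac:(lia).
  have Hm := Z.mod_pos_bound k (Z.of_nat p) pz.
  move: (k / _)%Z (k mod _)%Z Ek Hm => q r -> Hr.
  rewrite (_ : (Z.of_nat p * q + r = r + q * Z.of_nat p)%Z); last by lia.
  rewrite theta_shift plus_IZR mult_IZR -INR_IZR_INZ.
  have -> : IZR r + IZR q * INR p - INR p / T * (theta r + IZR q * T - theta 0) =
    IZR r - INR p / T * (theta r - theta 0) by field; lra.
  have r0 : theta 0 <= theta r by apply: theta_le; lia.
  have r1 : theta r <= theta 0 + T.
    by rewrite -theta_per; apply: theta_le; lia.
  have r2 : 0 <= IZR r by apply: IZR_le; lia.
  have r3 : IZR r <= INR p by rewrite INR_IZR_INZ; apply: IZR_le; lia.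
  have : INR p / T * (theta r - theta 0) <= INR p.
    have -> : INR p = INR p / T * T by field; lra.
    rewrite {1}(_ : INR p / T * T / T = INR p / T); last by field; lra.
    apply: Rmult_le_compat_l; lra.
  have : 0 <= INR p / T * (theta r - theta 0) by apply: Rmult_le_pos; lra.
  split_Rabs; lra.
exists (INR p + 1 + Rabs (INR p / T * theta 0)) => [|t].
  have := Rabs_pos (INR p / T * theta 0); lra.
have [Hl Hu] := idxP t.
have := step (idx t); have := step (idx t + 1)%Z; rewrite plus_IZR.
have := Rmult_lt_compat_l _ _ _ pT0 Hl; have := Rmult_le_compat_l _ _ _ (Rlt_le _ _ pT0) Hu.
move: (IZR (idx t)) => z; rewrite !Rmult_minus_distr_l.
split_Rabs; lra.
Qed.

(** By periodicity only the [p] gaps of one period occur, and their minimum is positive. *)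
Lemma impulse_gap : exists2 d, 0 < d & forall k, theta k + d <= theta (k + 1)%Z.
Proof.
have pz : (0 < Z.of_nat p)%Z by have := p_gt0; move/ltP; lia.
have [d d0 Hd] : exists2 d, 0 < d &
    forall r, (0 <= r < Z.of_nat p)%Z -> theta r + d <= theta (r + 1)%Z.
  elim: (p) => [|q [d d0 IH]]; first by exists 1 => [|r]; [lra|lia].
  set e := theta (Z.of_nat q + 1)%Z - theta (Z.of_nat q).
  have e0 : 0 < e by have := @theta_lt (Z.of_nat q) (Z.of_nat q + 1)%Z ltac:(lia); rewrite /e; lra.
  exists (Rmin d e) => [|r Hr]; first exact: Rmin_pos.
  have m1 := Rmin_l d e; have m2 := Rmin_r d e.
  case: (Z.eq_dec r (Z.of_nat q)) => [->|ne]; first by move: m2; rewrite {2}/e; lra.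
  by have := IH r ltac:(lia); lra.
exists d => // k.
have Ek := Z.div_mod k (Z.of_nat p) ltac:(lia).
have Hm := Z.mod_pos_bound k (Z.of_nat p) pz.
have := Hd _ Hm.
have := theta_shift (k mod Z.of_nat p) (k / Z.of_nat p).
have := theta_shift (k mod Z.of_nat p + 1) (k / Z.of_nat p).
have -> : (k mod Z.of_nat p + 1 + k / Z.of_nat p * Z.of_nat p = k + 1)%Z by lia.
have -> : (k mod Z.of_nat p + k / Z.of_nat p * Z.of_nat p = k)%Z by lia.
lra.
Qed.

End ImpulseTimes.

(** * Linear impulsive equations *)

Lemma eventually_pos_cont (G : R -> R) : ex_derive G 0 -> 0 < G 0 ->
  exists2 d, 0 < d & forall h, 0 < h < d -> 0 < G h.
Proof.
move=> /ex_derive_Reals_0 /derivable_continuous_pt c G0.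
have [d [d0 Hd]] := c (G 0) G0; exists d => // h Hh.
have := Hd h; rewrite /D_x /no_cond /dist /= /R_dist Rminus_0_r => H.
have := H ltac:(split; [split => //; lra|split_Rabs; lra]); split_Rabs; lra.
Qed.

(** In the comparison below, [G] is the margin left under the envelope. Between impulses it starts
    at zero with positive slope; just after an impulse it is already positive, and
    [eventually_pos_cont] serves. *)
Lemma eventually_pos_deriv (G : R -> R) l : is_derive G 0 l -> 0 < l -> G 0 = 0 ->
  exists2 d, 0 < d & forall h, 0 < h < d -> 0 < G h.
Proof.
move=> /is_derive_Reals D l0 G0.
have [d Hd] := D l l0; exists d => [|h Hh]; first exact: cond_pos.
have := Hd h (Rgt_not_eq h 0 (proj1 Hh)) ltac:(split_Rabs; lra).
rewrite Rplus_0_l G0 Rminus_0_r => H.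
have q0 : 0 < G h / h by split_Rabs; lra.
have -> : G h = G h / h * h by field; lra.
by apply: Rmult_lt_0_compat; lra.
Qed.

Section LinearImpulsive.

Variables (n : nat) (A B : mat n) (theta : Z -> R) (T : R) (p : nat).
Hypotheses (T_gt0 : 0 < T) (p_gt0 : (0 < p)%nat).
Hypothesis theta_lt : forall k1 k2, (k1 < k2)%Z -> theta k1 < theta k2.
Hypothesis theta_per : forall k, theta (k + Z.of_nat p)%Z = theta k + T.

Let idxP := idxP T_gt0 theta_lt theta_per.

(* The forcing terms [q], [w] are functions of time, so that, unlike solutions in the
   sense of [imp_sol], these are stable under differences. *)
Definition lin_imp (y q w : R -> vec n) :=
  (forall t, left_cont y t) /\
  (forall t, (forall k, t <> theta k) -> has_deriv y t (vadd (mv A (y t)) (q t))) /\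
  (forall k, right_lim y (theta k)
     (vadd (y (theta k)) (vadd (mv B (y (theta k))) (w (theta k))))).

Lemma imp_sol_lin h W y : imp_sol A B h W theta y ->
  lin_imp y (fun t => h t (y t)) (fun t => W (y t)).
Proof. by case=> ? [? [_ ?]]. Qed.

Lemma lin_imp_sub y1 q1 w1 y2 q2 w2 : lin_imp y1 q1 w1 -> lin_imp y2 q2 w2 ->
  lin_imp (fun t => vsub (y1 t) (y2 t)) (fun t => vsub (q1 t) (q2 t))
          (fun t => vsub (w1 t) (w2 t)).
Proof.
move=> [c1 [d1 j1]] [c2 [d2 j2]]; split; [|split].
- by move=> t; apply: left_cont_sub.
- move=> t Ht; have := has_deriv_sub (d1 t Ht) (d2 t Ht).
  by rewrite mvB (_ : vsub (vadd _ _) _ =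
    vadd (vsub (mv A (y1 t)) (mv A (y2 t))) (vsub (q1 t) (q2 t))) //; vec_ring.
- move=> k; have := right_lim_sub (j1 k) (j2 k).
  set t := theta k; rewrite mvB (_ : vsub (vadd _ _) _ =
    vadd (vsub (y1 t) (y2 t)) (vadd (vsub (mv B (y1 t)) (mv B (y2 t))) (vsub (w1 t) (w2 t)))) //.
  vec_ring.
Qed.

Lemma no_impulse_right t :
  exists2 d, 0 < d & forall r, t < r < t + d -> forall k, r <> theta k.
Proof.
case: (idxP t); move: (idx _ _) => k lo [hi|->].
  exists (theta (k + 1)%Z - t) => [|r Hr]; first lra.
  by apply: (not_impulse T_gt0 theta_lt theta_per (k := k)); lra.
exists (theta (k + 1 + 1)%Z - theta (k + 1)%Z) => [|r Hr].
  by have := @theta_lt (k + 1)%Z (k + 1 + 1)%Z ltac:(lia); lra.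
by apply: (not_impulse T_gt0 theta_lt theta_per (k := (k + 1)%Z)); lra.
Qed.

(** Forward uniqueness by real induction. A jump sends zero to zero, so the right limit at [t] is
    zero; Gronwall from [t + s] with [s] small carries this to [t + h], and left continuity handles
    the left limits. *)
Lemma lin_imp_zero u a b :
  lin_imp u (fun=> vzero n) (fun=> vzero n) -> u a = vzero n -> a <= b -> u b = vzero n.
Proof.
move=> [uc [ud uj]] ua ab.
have [c c0 Ac] := mv_bound A.
apply: (@real_induction (fun t => u t = vzero n) a b) => // t Ht.
  move=> ut; have [d d0 Hd] := no_impulse_right t; exists d => // h Hh.
  have lim : right_lim u t (vzero n).
    case: (classic (exists k, t = theta k)) => [[k Ek]|nk].
      have := uj k; rewrite -Ek ut mv0 (_ : vadd _ _ = vzero n) //; vec_ring.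
    have := ud t; rewrite -{2}ut => H; apply: (has_deriv_right_lim (H _)) => k Ek.
    by apply: nk; exists k.
  apply: vnorm_eq0; apply: le_epsilon => e e0; rewrite Rplus_0_l.
  have E0 := exp_pos (c * h).
  have [d' d'0 Hd'] := right_lim_norm lim (Rdiv_lt_0_compat _ _ e0 E0).
  set s := Rmin (d' / 2) h.
  have s0 : 0 < s by apply: Rmin_pos; lra.
  have s1 : s <= d' / 2 by apply: Rmin_l.
  have s2 : s <= h by apply: Rmin_r.
  have us : vnorm (u (t + s)) <= e / exp (c * h).
    by have := Hd' s ltac:(lra); rewrite (_ : vsub _ _ = u (t + s)) //; vec_ring.
  have [r Hr|G _] := @gronwall _ u (fun r => vadd (mv A (u r)) (vzero n)) c
    (t + s) (t + h) ltac:(lra).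
    split; first by apply: ud; apply: Hd; lra.
    by rewrite (_ : vadd _ _ = mv A (u r)) //; vec_ring.
  apply: (Rle_trans _ _ _ G).
  have -> : e = e / exp (c * h) * exp (c * h) by field; lra.
  apply: Rmult_le_compat => //; [exact: vnorm_ge0|exact: Rlt_le (exp_pos _)|].
  case: (Req_dec (c * (t + h - (t + s))) (c * h)) => [->|ne]; first lra.
  by apply: Rlt_le; apply: exp_increasing; nra.
move=> IH; apply: vnorm_eq0; apply: le_epsilon => e e0; rewrite Rplus_0_l.
have [d d0 Hd] := left_cont_norm (uc t) e0.
set s := Rmin (d / 2) (t - a).
have s0 : 0 < s by apply: Rmin_pos; lra.
have s1 : s <= d / 2 by apply: Rmin_l.
have s2 : s <= t - a by apply: Rmin_r.
have := Hd s ltac:(lra); rewrite (IH (t - s)); last lra.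
rewrite (_ : vsub _ _ = u t) //; vec_ring.
Qed.

(** * The transition matrix and the norm adapted to it *)

Variables (U : R -> R -> mat n) (N omega : R).
Hypothesis U_transition : transition_matrix A B theta U.
Hypotheses (N_gt0 : 0 < N) (omega_gt0 : 0 < omega).
Hypothesis U_le : forall t s, s <= t -> opnorm (U t s) <= N * exp (- omega * (t - s)).

Lemma transition_lin s v :
  lin_imp (fun t => mv (U t s) v) (fun=> vzero n) (fun=> vzero n).
Proof. exact: imp_sol_lin (U_transition s v).1. Qed.

Lemma transition_id s v : mv (U s s) v = v.
Proof. exact: (U_transition s v).2. Qed.

(** Both sides solve the homogeneous equation in [r] and agree at [r = t], so forward uniqueness
    applies. *)
Lemma transition_comp r t s v : t <= r -> mv (U r t) (mv (U t s) v) = mv (U r s) v.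
Proof.
move=> tr.
have := lin_imp_sub (transition_lin t (mv (U t s) v)) (transition_lin s v).
rewrite (_ : vsub (vzero n) (vzero n) = vzero n); last by vec_ring.
move=> /lin_imp_zero H; have {H} := H t r _ tr; rewrite /= transition_id => H.
apply: functional_extensionality => i.
have /(f_equal (fun y => y i)) := H ltac:(vec_ring).
rewrite /vsub /vzero; lra.
Qed.

Lemma transition_le t s v : s <= t ->
  vnorm (mv (U t s) v) <= N * exp (- omega * (t - s)) * vnorm v.
Proof.
move=> st; apply: Rle_trans (opnorm_bound _ _) _.
by apply: Rmult_le_compat_r; [exact: vnorm_ge0|exact: U_le].
Qed.

Lemma exp_decay_le1 r : 0 <= r -> exp (- omega * r) <= 1.
Proof.
move=> r0; rewrite -exp_0; case: r0 => [r0|<-]; last by rewrite Rmult_0_r; lra.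
by apply: Rlt_le; apply: exp_increasing; nra.
Qed.

(* [orbit_le t y c] says that [c] bounds the adapted norm [sup_(r >= t) e^(omega (r-t)) |U(r,t) y|],
   in which the linear flow contracts at rate [omega] with constant 1. *)
Definition orbit_le t y c :=
  forall r, t <= r -> vnorm (mv (U r t) y) <= c * exp (- omega * (r - t)).

Lemma orbit_le_vnorm t y : orbit_le t y (N * vnorm y).
Proof. by move=> r tr; have := transition_le y tr; lra. Qed.

Lemma vnorm_orbit_le t y c : orbit_le t y c -> vnorm y <= c.
Proof.
move=> /(_ t (Rle_refl t)).
by rewrite transition_id Rminus_diag Rmult_0_r exp_0 Rmult_1_r.
Qed.

Lemma orbit_le_add t y1 y2 c1 c2 :
  orbit_le t y1 c1 -> orbit_le t y2 c2 -> orbit_le t (vadd y1 y2) (c1 + c2).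
Proof.
move=> H1 H2 r tr; rewrite mvD; apply: Rle_trans (vnorm_add _ _) _.
by have := H1 r tr; have := H2 r tr; lra.
Qed.

Lemma orbit_le_mono t y c1 c2 : orbit_le t y c1 -> c1 <= c2 -> orbit_le t y c2.
Proof.
move=> H c12 r tr; apply: Rle_trans (H r tr) _.
by apply: Rmult_le_compat_r => //; apply: Rlt_le; exact: exp_pos.
Qed.

Lemma orbit_le_flow t t' y c : t <= t' -> orbit_le t y c ->
  orbit_le t' (mv (U t' t) y) (c * exp (- omega * (t' - t))).
Proof.
move=> tt' H r tr; rewrite transition_comp //.
have := H r ltac:(lra).
by rewrite (_ : - omega * (r - t) = - omega * (t' - t) + - omega * (r - t'));
  [rewrite exp_plus; lra|ring].
Qed.

(** The factor [N] falls only on the increment [e], not on the propagated bound [c]; many short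
    steps therefore accumulate no powers of [N]. *)
Lemma orbit_le_perturb t t' y y' c e : t <= t' -> orbit_le t y c ->
  vnorm (vsub y' (mv (U t' t) y)) <= e ->
  orbit_le t' y' (c * exp (- omega * (t' - t)) + N * e).
Proof.
move=> tt' H He.
rewrite (_ : y' = vadd (mv (U t' t) y) (vsub y' (mv (U t' t) y))); last by vec_ring.
apply: orbit_le_add (orbit_le_flow tt' H) _.
by apply: (orbit_le_mono (@orbit_le_vnorm _ _)); apply: Rmult_le_compat_l; lra.
Qed.

Lemma orbit_le_lim t y c : (forall e, 0 < e -> orbit_le t y (c + e)) -> orbit_le t y c.
Proof.
move=> H r tr; apply: le_epsilon => e e0.
have := H e e0 r tr; have := exp_decay_le1 (r := r - t) ltac:(lra); nra.
Qed.

(** The step stops short of the preceding impulse, so the flow is differentiable on [[t - h, t)];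
    [t] itself may be an impulse time. *)
Lemma transition_lip a t h v : (forall u, vnorm (mv A u) <= a * vnorm u) -> 0 <= a ->
  0 < h < t - theta (idx theta t) ->
  vnorm (vsub (mv (U t (t - h)) v) v) <= a * N * vnorm v * h.
Proof.
move=> Aa a0 Hh; have It := idxP t.
have := @lipschitz_left _ (fun r => mv (U r (t - h)) v) (fun r => mv A (mv (U r (t - h)) v))
  (a * N * vnorm v) (t - h) t ltac:(lra) _ ((transition_lin (t - h) v).1 t).
rewrite transition_id (_ : t - (t - h) = h); last by ring.
apply=> r Hr; split.
  have [_ [D _]] := transition_lin (t - h) v.
  rewrite (_ : mv A _ = vadd (mv A (mv (U r (t - h)) v)) (vzero n)); last by vec_ring.
  by apply: D; apply: (not_impulse T_gt0 theta_lt theta_per (k := idx theta t)); lra.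
apply: Rle_trans (Aa _) _; rewrite !Rmult_assoc; apply: Rmult_le_compat_l => //.
have := transition_le v (t := r) (s := t - h) ltac:(lra).
have := exp_decay_le1 (r := r - (t - h)) ltac:(lra).
have : 0 <= N * vnorm v by apply: Rmult_le_pos; [lra|exact: vnorm_ge0].
nra.
Qed.

(** * Comparison with an exponentially decaying envelope *)

Section Comparison.

Variables (L_f L_W ell kap sig K C0 : R).
Hypotheses (kap_gt0 : 0 < kap) (sig_gt0 : 0 < sig) (K_ge0 : 0 <= K).
Hypotheses (L_f_ge0 : 0 <= L_f) (L_W_ge0 : 0 <= L_W) (ell_ge0 : 0 <= ell).
(** Here [sig] is the slack at a jump and [2 * kap] the decay rate remaining between jumps once the
    sawtooth is paid for. [K_kap] and [K_sig] make [K] large enough to absorb the forcing [eta] in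
    the two situations. *)
Hypothesis exp_ell : exp ell = 1 + N * L_W + sig.
Hypothesis rate : omega - N * L_f - INR p / T * ell = 2 * kap.
Hypothesis idx_C0 : forall t, Rabs (IZR (idx theta t) - INR p / T * t) <= C0.
Hypothesis K_kap : N <= kap * exp (- ell * C0) * K.
Hypothesis K_sig : N <= sig * exp (- ell * C0) * K.

(* The sawtooth [weight] stays between positive bounds, although it is multiplied by
   [exp ell > 1 + N L_W] at each impulse: this absorbs the jumps. *)
Definition weight t := exp (ell * (IZR (idx theta t) - INR p / T * t)).

Lemma weight_bounds t : exp (- ell * C0) <= weight t <= exp (ell * C0).
Proof.
have mono x y : x <= y -> exp x <= exp y.
  by case=> [xy|->]; [apply: Rlt_le; apply: exp_increasing|lra].
by have := idx_C0 t; split; apply: mono; split_Rabs; nra.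
Qed.

Lemma weight_left t h : 0 <= h < t - theta (idx theta t) ->
  weight (t - h) = weight t * exp (INR p / T * ell * h).
Proof.
by move=> Hh; rewrite /weight (idx_left T_gt0 theta_lt theta_per Hh) -exp_plus; f_equal; ring.
Qed.

Lemma weight_right t : (forall k, t <> theta k) -> exists2 d, 0 < d & forall h, 0 < h < d ->
  weight (t + h) = weight t * exp (- (INR p / T * ell) * h).
Proof.
move=> /(idx_right T_gt0 theta_lt theta_per)[d d0 Hd]; exists d => // h /Hd.
by rewrite /weight => ->; rewrite -exp_plus; f_equal; ring.
Qed.

Lemma weight_right_theta k : exists2 d, 0 < d & forall h, 0 < h < d ->
  weight (theta k + h) = exp ell * weight (theta k) * exp (- (INR p / T * ell) * h).
Proof.
have [d d0 Hd] := idx_right_theta T_gt0 theta_lt theta_per k; exists d => // h /Hd.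
rewrite /weight (idx_theta T_gt0 theta_lt theta_per) => ->.
by rewrite -!exp_plus minus_IZR; f_equal; ring.
Qed.

(** The first summand is the fading memory of the data at time [s], the second the lasting effect of
    a forcing of size [eta]. *)
Definition envelope c eta s t := weight t * (c * exp (- kap * (t - s)) + K * eta).

Lemma envelope_step c eta s t h :
  c * exp (- kap * (t + h - s)) + K * eta =
  c * exp (- kap * (t - s)) * exp (- kap * h) + K * eta.
Proof.
by rewrite (_ : - kap * (t + h - s) = - kap * (t - s) + - kap * h);
  [rewrite exp_plus; ring|ring].
Qed.

Section Step.

Variables (y q w : R -> vec n) (s c eta : R).
Hypotheses (y_sol : lin_imp y q w) (c_gt0 : 0 < c) (eta_ge0 : 0 <= eta).

Let E t := c * exp (- kap * (t - s)).

(** The deviation of [y] from the free flow started at [(t, y t)] has derivative [q t] there, so to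
    first order it costs [N h |q t|]. The decay rate in [rate] beats this cost. *)
Lemma comparison_right t :
  (forall k, t <> theta k) -> vnorm (q t) <= L_f * vnorm (y t) + eta ->
  orbit_le t (y t) (envelope c eta s t) ->
  exists2 d, 0 < d & forall h, 0 < h < d -> orbit_le (t + h) (y (t + h)) (envelope c eta s (t + h)).
Proof.
move=> nt Hq Hy.
have E0 : 0 < E t by apply: Rmult_lt_0_compat (exp_pos _).
have [g1 _] := weight_bounds t; have g0 : 0 < weight t := exp_pos _.
have e1 := exp_pos (- ell * C0).
(* Makes the error term [N * e] half of the strict margin [kap * weight t * E t]. *)
set e := kap * weight t * E t / (2 * N).
have e0 : 0 < e by apply: Rdiv_lt_0_compat; [apply: Rmult_lt_0_compat => //; nra|lra].
set b := envelope c eta s t.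
have Eb : b = weight t * (E t + K * eta) by [].
set Q := L_f * b + eta.
have HQ : vnorm (q t) <= Q.
  by have := vnorm_orbit_le Hy; rewrite -/b /Q; nra.
have dz : has_deriv (fun r => vsub (y r) (mv (U r t) (y t))) t (q t).
  have := has_deriv_sub (y_sol.2.1 t nt) ((transition_lin t (y t)).2.1 t nt).
  rewrite transition_id (_ : vsub (vadd _ _) _ = q t) //; vec_ring.
have [d1 d10 H1] := has_deriv_norm dz e0.
have [d2 d20 H2] := weight_right nt.
(* Envelope at [t + h] minus the bound that [orbit_le_perturb] provides. *)
pose G h := weight t * exp (- (INR p / T * ell) * h) * (E t * exp (- kap * h) + K * eta)
  - (b * exp (- omega * h) + N * (h * (Q + e))).
have [|||d3 d30 H3] := @eventually_pos_deriv G
  (- (INR p / T * ell) * b - weight t * kap * E t + omega * b - N * (Q + e)).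
- rewrite /G; auto_derive => //; rewrite !Rmult_0_r exp_0 Eb; ring.
- have -> : - (INR p / T * ell) * b - weight t * kap * E t + omega * b - N * (Q + e) =
    (omega - N * L_f - INR p / T * ell) * b - weight t * kap * E t - N * eta - N * e.
    by rewrite /Q; ring.
  have -> : N * e = kap * weight t * E t / 2 by rewrite /e; field; lra.
  rewrite rate Eb.
  have : N * eta <= kap * weight t * K * eta.
    apply: Rmult_le_compat_r => //; apply: Rle_trans K_kap _.
    by apply: Rmult_le_compat_r => //; apply: Rmult_le_compat_l; lra.
  have : 0 < kap * weight t * E t by apply: Rmult_lt_0_compat => //; apply: Rmult_lt_0_compat.
  have : 0 <= kap * weight t * K * eta.
    by do 2! apply: Rmult_le_pos => //; apply: Rmult_le_pos; lra.
  nra.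
- by rewrite /G !Rmult_0_r !exp_0 Eb; ring.
exists (Rmin d1 (Rmin d2 d3)) => [|h Hh]; first by repeat apply: Rmin_pos.
have m1 := Rmin_l d1 (Rmin d2 d3); have m2 := Rmin_r d1 (Rmin d2 d3).
have m3 := Rmin_l d2 d3; have m4 := Rmin_r d2 d3.
have err : vnorm (vsub (y (t + h)) (mv (U (t + h) t) (y t))) <= h * (Q + e).
  have := H1 h ltac:(lra); have := vnorm_le_sub (vsub (y (t + h)) (mv (U (t + h) t) (y t)))
    (vscale h (q t)).
  rewrite vnormZ Rabs_pos_eq; last lra.
  rewrite transition_id (_ : vsub (y t) (y t) = vzero n); last by vec_ring.
  rewrite (_ : vsub (vsub _ _) (vzero n) = vsub (y (t + h)) (mv (U (t + h) t) (y t))); last by vec_ring.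
  nra.
apply: orbit_le_mono (orbit_le_perturb _ Hy err) _; first lra.
rewrite /envelope envelope_step H2 -/(E t); last lra.
have := H3 h ltac:(lra); rewrite /G -Eb (_ : t + h - t = h); [lra|ring].
Qed.

(** The jump adds at most [N (L_W b + eta)] to the bound [b], while the weight is multiplied by
    [exp ell]; [sig] leaves a positive margin immediately after the impulse. *)
Lemma comparison_right_theta k : let t := theta k in
  vnorm (w t) <= L_W * vnorm (y t) + eta ->
  orbit_le t (y t) (envelope c eta s t) ->
  exists2 d, 0 < d & forall h, 0 < h < d -> orbit_le (t + h) (y (t + h)) (envelope c eta s (t + h)).
Proof.
move=> t Hw Hy.
have E0 : 0 < E t by apply: Rmult_lt_0_compat (exp_pos _).
have [g1 _] := weight_bounds t; have g0 : 0 < weight t := exp_pos _.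
set e := sig * weight t * E t / (2 * N).
have e0 : 0 < e by apply: Rdiv_lt_0_compat; [apply: Rmult_lt_0_compat => //; nra|lra].
set b := envelope c eta s t.
have Eb : b = weight t * (E t + K * eta) by [].
set Q := L_W * b + eta.
have HQ : vnorm (w t) <= Q.
  by have := vnorm_orbit_le Hy; rewrite -/b /Q; nra.
have jz : right_lim (fun r => vsub (y r) (mv (U r t) (y t))) t (w t).
  have := right_lim_sub (y_sol.2.2 k) ((transition_lin t (y t)).2.2 k).
  rewrite -/t transition_id (_ : vsub (vadd _ _) _ = w t) //; vec_ring.
have [d1 d10 H1] := right_lim_norm jz e0.
have [d2 d20 H2] := weight_right_theta k.
pose G h := exp ell * weight t * exp (- (INR p / T * ell) * h) * (E t * exp (- kap * h) + K * eta)
  - (b * exp (- omega * h) + N * (Q + e)).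
have [||d3 d30 H3] := @eventually_pos_cont G.
- by rewrite /G; auto_derive.
- rewrite /G !Rmult_0_r !exp_0 !Rmult_1_r Rmult_assoc -Eb exp_ell.
  have -> : (1 + N * L_W + sig) * b - (b + N * (Q + e)) = sig * b - N * eta - N * e.
    by rewrite /Q; ring.
  have -> : N * e = sig * weight t * E t / 2 by rewrite /e; field; lra.
  rewrite Eb.
  have : N * eta <= sig * weight t * K * eta.
    apply: Rmult_le_compat_r => //; apply: Rle_trans K_sig _.
    by apply: Rmult_le_compat_r => //; apply: Rmult_le_compat_l; lra.
  have : 0 < sig * weight t * E t by apply: Rmult_lt_0_compat => //; apply: Rmult_lt_0_compat.
  nra.
exists (Rmin d1 (Rmin d2 d3)) => [|h Hh]; first by repeat apply: Rmin_pos.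
have m1 := Rmin_l d1 (Rmin d2 d3); have m2 := Rmin_r d1 (Rmin d2 d3).
have m3 := Rmin_l d2 d3; have m4 := Rmin_r d2 d3.
have err : vnorm (vsub (y (t + h)) (mv (U (t + h) t) (y t))) <= Q + e.
  have := H1 h ltac:(lra); have := vnorm_le_sub (vsub (y (t + h)) (mv (U (t + h) t) (y t))) (w t).
  lra.
apply: orbit_le_mono (orbit_le_perturb _ Hy err) _; first lra.
rewrite /envelope envelope_step H2 -/(E t); last lra.
have := H3 h ltac:(lra); rewrite /G -/t -Eb (_ : t + h - t = h); [lra|ring].
Qed.

(** The envelope is left continuous, and over a short step before [t] both [y] and the free flow
    move little; the bound at [t - h] thus passes to [t] up to an arbitrary [e]. *)
Lemma comparison_left t : s < t ->
  (forall r, s <= r < t -> orbit_le r (y r) (envelope c eta s r)) ->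
  orbit_le t (y t) (envelope c eta s t).
Proof.
move=> st IH; apply: orbit_le_lim => e e0.
have [a a0 Aa] := mv_bound A.
have g0 : 0 < weight t := exp_pos _.
have c2 := exp_pos (ell * C0).
(* Bounds [y] on [[s, t)] independently of the step [h], which is chosen only later. *)
pose M := exp (ell * C0) * (c + K * eta).
have cK : 0 <= c + K * eta by have := Rmult_le_pos _ _ K_ge0 eta_ge0; lra.
have M0 : 0 <= M by apply: Rmult_le_pos => //; lra.
have leM r : s <= r < t -> vnorm (y r) <= M.
  move=> Hr; apply: Rle_trans (vnorm_orbit_le (IH r Hr)) _.
  have [g1 g2] := weight_bounds r.
  have e1 : exp (- kap * (r - s)) <= 1.
    have [rs|->] : s < r \/ s = r by lra.
      by rewrite -exp_0; apply: Rlt_le; apply: exp_increasing; nra.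
    by rewrite Rminus_diag Rmult_0_r exp_0; lra.
  have := exp_pos (- kap * (r - s)) => e2.
  apply: Rmult_le_compat; [exact: Rlt_le (exp_pos _)| |done|nra].
  by have := Rmult_le_pos _ _ K_ge0 eta_ge0; nra.
have e20 : 0 < e / (2 * N) by apply: Rdiv_lt_0_compat; lra.
have [d1 d10 H1] := left_cont_norm (y_sol.1 t) e20.
pose G h := envelope c eta s t + e / 2 -
  (weight t * exp (INR p / T * ell * h) * (E t * exp (kap * h) + K * eta) + N * (a * N * M * h)).
have [||d2 d20 H2] := @eventually_pos_cont G.
- by rewrite /G; auto_derive.
- by rewrite /G !Rmult_0_r !exp_0 /envelope -/(E t); lra.
have [It _] := idxP t.
pose d3 := Rmin (t - s) (t - theta (idx theta t)).
have d30 : 0 < d3 by apply: Rmin_pos; lra.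
pose h := Rmin d1 (Rmin d2 d3) / 2.
have h0 : 0 < Rmin d1 (Rmin d2 d3) by apply: Rmin_pos => //; apply: Rmin_pos.
have m1 := Rmin_l d1 (Rmin d2 d3); have m2 := Rmin_r d1 (Rmin d2 d3).
have m3 := Rmin_l d2 d3; have m4 := Rmin_r d2 d3.
have m5 : d3 <= t - s by apply: Rmin_l.
have m6 : d3 <= t - theta (idx theta t) by apply: Rmin_r.
have hE : h = Rmin d1 (Rmin d2 d3) / 2 by [].
have err : vnorm (vsub (y t) (mv (U t (t - h)) (y (t - h)))) <= e / (2 * N) + a * N * M * h.
  have := H1 h ltac:(lra).
  have := transition_lip (t := t) (h := h) (y (t - h)) Aa a0 ltac:(lra).
  have : a * N * vnorm (y (t - h)) * h <= a * N * M * h.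
    apply: Rmult_le_compat_r; first lra.
    by apply: Rmult_le_compat_l; [apply: Rmult_le_pos; lra|apply: leM; lra].
  have := vnorm_add (vsub (y t) (y (t - h))) (vsub (y (t - h)) (mv (U t (t - h)) (y (t - h)))).
  rewrite (vnorm_subC (y (t - h))).
  rewrite (_ : vadd _ _ = vsub (y t) (mv (U t (t - h)) (y (t - h)))); last by vec_ring.
  lra.
apply: orbit_le_mono (orbit_le_perturb _ (IH (t - h) _) err) _; [lra|lra|].
rewrite (_ : t - (t - h) = h); last by ring.
have b0 : 0 <= envelope c eta s (t - h).
  apply: Rmult_le_pos; first exact: Rlt_le (exp_pos _).
  have := exp_pos (- kap * (t - h - s)); have := Rmult_le_pos _ _ K_ge0 eta_ge0; nra.
have e1 := exp_decay_le1 (r := h) ltac:(lra).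
have : envelope c eta s (t - h) * exp (- omega * h) <= envelope c eta s (t - h) by nra.
have := H2 h ltac:(lra); rewrite /G.
rewrite {3}/envelope weight_left; last lra.
rewrite (_ : c * exp (- kap * (t - h - s)) = E t * exp (kap * h)); last first.
  by rewrite /E Rmult_assoc -exp_plus; do 2! f_equal; ring.
have -> : N * (e / (2 * N) + a * N * M * h) = e / 2 + N * (a * N * M * h) by field; lra.
lra.
Qed.

End Step.

Lemma comparison_envelope y q w s t r eta :
  lin_imp y q w -> s <= t -> 0 < r -> 0 <= eta -> vnorm (y s) <= r ->
  (forall u, s <= u <= t -> vnorm (q u) <= L_f * vnorm (y u) + eta /\
                            vnorm (w u) <= L_W * vnorm (y u) + eta) ->
  vnorm (y t) <= exp (ell * C0) * (N * r / exp (- ell * C0) * exp (- kap * (t - s)) + K * eta).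
Proof.
move=> y_sol st r0 eta0 ys Hqw.
have e1 := exp_pos (- ell * C0).
(* With this [c] even the least possible weight covers the initial bound [N * r] at time [s]. *)
set c := N * r / exp (- ell * C0).
have c0 : 0 < c by apply: Rdiv_lt_0_compat => //; apply: Rmult_lt_0_compat.
have cE := exp_pos (- kap * (t - s)).
have Ke := Rmult_le_pos _ _ K_ge0 eta0.
apply: (Rle_trans _ (envelope c eta s t)); last first.
  by apply: Rmult_le_compat_r; [nra|apply: (weight_bounds t).2].
apply: (@vnorm_orbit_le t).
apply: (@real_induction (fun t => orbit_le t (y t) (envelope c eta s t)) s t) => //.
- apply: orbit_le_mono (@orbit_le_vnorm _ _) _.
  rewrite /envelope Rminus_diag Rmult_0_r exp_0 Rmult_1_r.
  have [g1 _] := weight_bounds s.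
  have : exp (- ell * C0) * c = N * r by rewrite /c; field; lra.
  nra.
- move=> u Hu; have [Hq Hw] := Hqw u ltac:(lra).
  case: (classic (exists k, u = theta k)) => [[k Ek]|nk].
    by rewrite Ek in Hw *; apply: (comparison_right_theta y_sol c0 eta0 Hw).
  apply: (comparison_right y_sol c0 eta0) => // k Ek; apply: nk; by exists k.
- by move=> u Hu; apply: (comparison_left y_sol c0 eta0); lra.
Qed.

End Comparison.

(** Chooses the comparison constants from the strict inequality on the rates. [C] and [kap] precede
    the solution and the times, so the estimate is uniform over all of them. *)
Lemma lin_imp_estimate L_f L_W : 0 < L_f -> 0 < L_W ->
  - omega + N * L_f + INR p / T * ln (1 + N * L_W) < 0 ->
  exists C kap, 0 < C /\ 0 < kap /\ forall y q w s t r eta,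
  lin_imp y q w -> s <= t -> 0 < r -> 0 <= eta -> vnorm (y s) <= r ->
  (forall u, s <= u <= t -> vnorm (q u) <= L_f * vnorm (y u) + eta /\
                            vnorm (w u) <= L_W * vnorm (y u) + eta) ->
  vnorm (y t) <= C * (r * exp (- kap * (t - s)) + eta).
Proof.
move=> Lf0 LW0 Hrate.
have [C0 C00 HC0] := idx_bound T_gt0 p_gt0 theta_lt theta_per.
have p0 := p_real_gt0 p_gt0; have pT0 : 0 < INR p / T by apply: Rdiv_lt_0_compat.
have NLW : 0 < N * L_W by apply: Rmult_lt_0_compat.
set lam := omega - N * L_f - INR p / T * ln (1 + N * L_W).
have lam0 : 0 < lam by rewrite /lam; lra.
(* Half of the spare rate [lam] raises [ell] above [ln (1 + N * L_W)], making [sig] positive; the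
   other half is [2 * kap]. *)
set k0 := lam / 2 / (INR p / T).
have k00 : 0 < k0 by apply: Rdiv_lt_0_compat; lra.
set ell := ln (1 + N * L_W) + k0.
set sig := exp ell - (1 + N * L_W).
have expE : exp ell = (1 + N * L_W) * exp k0 by rewrite exp_plus exp_ln; lra.
have sig0 : 0 < sig.
  by rewrite /sig expE; have := exp_increasing _ _ k00; rewrite exp_0; nra.
have ell0 : 0 <= ell.
  by have := ln_increasing 1 (1 + N * L_W) ltac:(lra) ltac:(lra); rewrite ln_1 /ell; lra.
set kap := lam / 4.
have kap0 : 0 < kap by rewrite /kap; lra.
have rate : omega - N * L_f - INR p / T * ell = 2 * kap.
  by rewrite /ell /k0 /kap /lam; field; lra.
have g0 := exp_pos (- ell * C0); set g := exp _ in g0.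
have a1 : 0 < N / (kap * g) by apply: Rdiv_lt_0_compat => //; apply: Rmult_lt_0_compat.
have a2 : 0 < N / (sig * g) by apply: Rdiv_lt_0_compat => //; apply: Rmult_lt_0_compat.
set K := N / (kap * g) + N / (sig * g).
have K1 : N <= kap * g * K.
  have -> : kap * g * K = N + kap * g * (N / (sig * g)) by rewrite /K; field; lra.
  have : 0 < kap * g * (N / (sig * g)) by repeat apply: Rmult_lt_0_compat => //.
  lra.
have K2 : N <= sig * g * K.
  have -> : sig * g * K = N + sig * g * (N / (kap * g)) by rewrite /K; field; lra.
  have : 0 < sig * g * (N / (kap * g)) by repeat apply: Rmult_lt_0_compat => //.
  lra.
have K0 : 0 < K by rewrite /K; lra.
have Ng0 : 0 < N / g by apply: Rdiv_lt_0_compat.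
have G0 := exp_pos (ell * C0).
exists (exp (ell * C0) * (N / g + K)), kap; split; first by apply: Rmult_lt_0_compat; lra.
split => // y q w s t r eta y_sol st r0 eta0 ys Hqw.
have expell : exp ell = 1 + N * L_W + sig by rewrite /sig; ring.
have := comparison_envelope kap0 sig0 (Rlt_le _ _ K0) (Rlt_le _ _ Lf0) (Rlt_le _ _ LW0)
  ell0 expell rate HC0 K1 K2 y_sol st r0 eta0 ys Hqw.
move/Rle_trans; apply; rewrite Rmult_assoc; apply: Rmult_le_compat_l; first lra.
rewrite -/g; have E0 := exp_pos (- kap * (t - s)).
have -> : N * r / g * exp (- kap * (t - s)) = N / g * (r * exp (- kap * (t - s))).
  by field; lra.
have : 0 < r * exp (- kap * (t - s)) by apply: Rmult_lt_0_compat.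
move=> ?; nra.
Qed.

End LinearImpulsive.

(** * Excursions *)

Lemma dot_ge n (u v : vec n) : - (vnorm u * vnorm v) <= dot u v.
Proof.
have := dot_le (vscale (-1) u) v.
by rewrite dotZl vnormZ Rabs_Ropp Rabs_R1; lra.
Qed.

Lemma exp_small kap e : 0 < kap -> 0 < e -> exists2 S, 0 <= S & exp (- kap * S) <= e.
Proof.
move=> k0 e0; exists (Rabs (ln e) / kap).
  by apply: Rmult_le_pos; [exact: Rabs_pos|apply: Rlt_le; apply: Rinv_0_lt_compat].
have -> : - kap * (Rabs (ln e) / kap) = - Rabs (ln e) by field; lra.
rewrite -{2}(exp_ln e e0); have : - Rabs (ln e) <= ln e by split_Rabs; lra.
by case=> [lt|->]; [apply: Rlt_le; apply: exp_increasing|lra].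
Qed.

Lemma periodic_bounded m (G : R -> vec m) T : 0 < T -> (forall t, G (t + T) = G t) ->
  (forall t e, 0 < e -> exists2 d, 0 < d &
     forall t', Rabs (t' - t) < d -> vnorm (vsub (G t') (G t)) < e) ->
  exists M, forall t, vnorm (G t) <= M.
Proof.
move=> T0 per cont.
have [t _|tM [HM _]] := continuity_ab_maj (fun t => vnorm (G t)) 0 T (Rlt_le _ _ T0).
  move=> e e0; have [d d0 Hd] := cont t e e0; exists d; split => // t' [_ Ht'].
  have := Hd t' Ht'; have := vnorm_le_sub (G t') (G t); have := vnorm_le_sub (G t) (G t').
  rewrite (vnorm_subC (G t)) /dist /= /R_dist; split_Rabs; lra.
exists (vnorm (G tM)) => t.
have perN (i : nat) r : G (r + INR i * T) = G r.
  elim: i => [|i IH]; first by rewrite /= Rmult_0_l Rplus_0_r.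
  by rewrite (_ : r + INR i.+1 * T = r + INR i * T + T) ?per // S_INR; ring.
have perZ j r : G (r + IZR j * T) = G r.
  case: (Z_le_gt_dec 0 j) => Hj.
    by rewrite -(Z2Nat.id j) // -INR_IZR_INZ perN.
  rewrite -(perN (Z.to_nat (- j)) (r + _)) INR_IZR_INZ Z2Nat.id; last by lia.
  by rewrite opp_IZR; f_equal; ring.
have [u1 u2] := archimed (t / T).
set j := up _ in u1 u2.
(* Since [j - 1 <= t / T < j], this translate of [t] lies in [[0, T]]. *)
rewrite -(perZ (1 - j)%Z t); apply: HM.
have v1 := Rmult_gt_compat_r T _ _ T0 u1.
have v2 := Rmult_le_compat_r T _ _ (Rlt_le _ _ T0) u2.
have Et : t / T * T = t by field; lra.
by move: v1 v2; rewrite minus_IZR Rmult_minus_distr_r Et; lra.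
Qed.

(** If an impulse falls in the first third, the next one comes after [u + tau] because [tau < d], so
    the last third is free; otherwise the first third is. *)
Lemma impulse_free_interval (theta : Z -> R) d u tau :
  (forall k1 k2, (k1 < k2)%Z -> theta k1 < theta k2) ->
  (forall k, theta k + d <= theta (k + 1)%Z) -> 0 < tau < d ->
  exists a, u <= a /\ a + tau / 3 <= u + tau /\
    forall t, a <= t <= a + tau / 3 -> forall k, t <> theta k.
Proof.
move=> lt_th gap Htau.
case: (classic (exists k, u <= theta k <= u + tau / 3)) => [[k1 H1]|no]; last first.
  exists u; split; [lra|split; [lra|]] => t Ht k Ek.
  by apply: no; exists k; lra.
exists (u + 2 * tau / 3); split; [lra|split; [lra|]] => t Ht k2 Ek.
have k12 : (k1 + 1 <= k2)%Z.
  have : ~ (k2 <= k1)%Z by move=> /(theta_le lt_th); lra.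
  lia.
by have := theta_le lt_th k12; have := gap k1; lra.
Qed.

(* Otherwise [dot v (h a)] would grow by more than [2 e |h a|]. *)
Lemma forced_excursion n (v l h : R -> vec n) K Kh H tau a e :
  0 < H -> 0 <= K -> 0 < tau -> Kh * tau <= H / 2 -> 0 < e -> (2 + tau * K) * e < tau * (H / 2) ->
  (forall t, a <= t <= a + tau -> has_deriv v t (vadd (l t) (h t)) /\
     vnorm (l t) <= K * vnorm (v t) /\ vnorm (vsub (h t) (h a)) <= Kh * (t - a)) ->
  H <= vnorm (h a) ->
  exists2 t, a <= t <= a + tau & e < vnorm (v t).
Proof.
move=> H0 K0 tau0 HKh e0 He Hv Hha; apply: NNPP => no.
have small t : a <= t <= a + tau -> vnorm (v t) <= e.
  by move=> Ht; apply: Rnot_lt_le => lt; apply: no; exists t.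
have [t Ht|c [Hc ca]] := @MVT_cor2 (fun s => dot (v s) (h a))
  (fun s => dot (vadd (l s) (h s)) (h a)) a (a + tau) ltac:(lra).
  by apply: has_deriv_dot; apply: (Hv t Ht).1.
have [_ [Hl Hh]] := Hv c ltac:(lra).
have S1 := small a ltac:(lra); have S2 := small (a + tau) ltac:(lra); have S3 := small c ltac:(lra).
move: Hc; rewrite dotDl (_ : a + tau - a = tau); last by ring.
have -> : dot (h c) (h a) = vnorm (h a) * vnorm (h a) + dot (vsub (h c) (h a)) (h a).
  by rewrite dotBl vnorm_sqr; ring.
have := dot_ge (vsub (h c) (h a)) (h a); have := dot_ge (l c) (h a).
have := dot_ge (v a) (h a); have := dot_le (v a) (h a); have := dot_le (v (a + tau)) (h a).
set N := vnorm (h a) in Hha *.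
move=> B1 B2 B3 B4 B5 Hc.
have N0 : 0 < N by lra.
have C1 : vnorm (v (a + tau)) * N <= e * N by nra.
have C2 : vnorm (v a) * N <= e * N by nra.
have C3 : vnorm (l c) * N <= K * e * N.
  apply: Rmult_le_compat_r; first lra.
  by apply: Rle_trans Hl _; apply: Rmult_le_compat_l.
have HH : vnorm (vsub (h c) (h a)) <= H / 2.
  case: (Rle_or_lt 0 Kh) => s; first by nra.
  by have := vnorm_ge0 (vsub (h c) (h a)); nra.
have C4 : vnorm (vsub (h c) (h a)) * N <= H / 2 * N by nra.
have C5 : H * N <= N * N by nra.
(* The slope at [c] is at least [(H / 2 - K * e) * N], the total change at most [2 * e * N].
   Dividing by [N] contradicts the smallness of [e]. *)
have D1 : (H / 2 - K * e) * N * tau <= 2 * e * N.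
  have : (H / 2 - K * e) * N * tau <=
    (dot (l c) (h a) + (N * N + dot (vsub (h c) (h a)) (h a))) * tau.
    apply: Rmult_le_compat_r; lra.
  lra.
have : N * ((H / 2 - K * e) * tau - 2 * e) <= 0 by lra.
nra.
Qed.

(** * Transfer of sensitivity to the impulsive system *)

Theorem theorem1
  (m n : nat)
  (F : R -> vec m -> vec m)
  (f : R -> vec n -> vec n) (g : vec m -> vec n) (W : vec n -> vec n)
  (A B : mat n) (theta : Z -> R) (T : R) (p : nat)
  (U : R -> R -> mat n) (N omega : R)
  (Lambda : vec m -> Prop)
  (M_f M_W L_F L_f L_1 L_2 L_W : R)
  (phi : (R -> vec m) -> R -> vec n)
  (* setting *)
  (HT : 0 < T) (Hp : (0 < p)%nat)
  (HFcont : vcont2 F) (HFper : forall t x, F (t + T) x = F t x)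
  (HAne : exists x, inA F x)
  (HLam : compact_set Lambda)
  (HLamA : forall x, inA F x -> forall t, Lambda (x t))
  (Hfcont : vcont2 f) (Hgcont : vcont1 g) (HWcont : vcont1 W)
  (Hfper : forall t y, f (t + T) y = f t y)
  (Hth_incr : forall k1 k2, (k1 < k2)%Z -> theta k1 < theta k2)
  (Hth_per : forall k, theta (k + Z.of_nat p)%Z = theta k + T)
  (HU : transition_matrix A B theta U)
  (* (A1), (A2) *)
  (HA1 : mmul A B = mmul B A /\ mdet (madd (mid n) B) <> 0)
  (HA2 : cond_A2 A B p T)
  (* N, omega as provided by (A1),(A2) *)
  (HN : 0 < N) (Homega : 0 < omega)
  (HUbound : forall t s, s <= t -> opnorm (U t s) <= N * exp (- omega * (t - s)))
  (* (A3) *)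
  (HMf : 0 < M_f) (HMW : 0 < M_W)
  (HA3f : forall t y, vnorm (f t y) <= M_f)
  (HA3W : forall y, vnorm (W y) <= M_W)
  (* (A4) *)
  (HLF : 0 < L_F) (HLf : 0 < L_f) (HL1 : 0 < L_1) (HL2 : 0 < L_2) (HLW : 0 < L_W)
  (HA4F : forall t x1 x2, Lambda x1 -> Lambda x2 ->
            vnorm (vsub (F t x1) (F t x2)) <= L_F * vnorm (vsub x1 x2))
  (HA4f : forall t y1 y2, vnorm (vsub (f t y1) (f t y2)) <= L_f * vnorm (vsub y1 y2))
  (HA4g : forall x1 x2, Lambda x1 -> Lambda x2 ->
            L_1 * vnorm (vsub x1 x2) <= vnorm (vsub (g x1) (g x2)) /\
            vnorm (vsub (g x1) (g x2)) <= L_2 * vnorm (vsub x1 x2))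
  (HA4W : forall y1 y2, vnorm (vsub (W y1) (W y2)) <= L_W * vnorm (vsub y1 y2))
  (* (A5), (A6), (A7) *)
  (HA5 : N * (L_f / omega + INR p * L_W / (1 - exp (- omega * T))) < 1)
  (HA6 : - omega + N * L_f + INR p / T * ln (1 + N * L_W) < 0)
  (HA7 : L_W * opnorm (minv (madd (mid n) B)) < 1)
  (* phi x is the (unique) solution of (2) bounded on R, for x in \mathscr A *)
  (Hphi : forall x, inA F x ->
     imp_sol A B (fun t y => vadd (f t y) (g (x t))) W theta (phi x) /\
     bounded_fun (phi x))
  (* sensitivity of (1) *)
  (Hsens : exists eps0 Delta, 0 < eps0 /\ 0 < Delta /\
     forall delta0, 0 < delta0 -> forall x, inA F x ->
       exists xb t0 (J : R -> Prop), inA F xb /\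
         is_interval J /\ (forall t, J t -> t0 <= t) /\ length_ge J Delta /\
         vnorm (vsub (x t0) (xb t0)) < delta0 /\
         (forall t, J t -> vnorm (vsub (x t) (xb t)) > eps0)) :
  (* sensitivity of (2) *)
  exists eps1 Deltab, 0 < eps1 /\ 0 < Deltab /\
     forall delta1, 0 < delta1 -> forall x, inA F x ->
       exists xb t0 (J1 : R -> Prop), inA F xb /\
         is_interval J1 /\ (forall t, J1 t -> t0 <= t) /\ length_ge J1 Deltab /\
         (forall k1 k2, J1 (theta k1) -> J1 (theta k2) -> k1 = k2) /\
         vnorm (vsub (phi x t0) (phi xb t0)) < delta1 /\
         (forall t, J1 t -> vnorm (vsub (phi x t) (phi xb t)) > eps1).
Proof.
have [eps0 [Delta [eps00 [Delta0 sens]]]] := Hsens.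
have [x0 Ax0] := HAne.
have [[ML HML] _] := HLam.
set z0 := x0 0.
have Lz0 : Lambda z0 by apply: HLamA.
have ML0 : 0 <= ML by have := HML _ Lz0; have := vnorm_ge0 z0; lra.
have diam u v : Lambda u -> Lambda v -> vnorm (vsub u v) <= 2 * ML.
  by move=> /HML Lu /HML Lv; have := vnorm_sub u v; lra.
(* Periodicity bounds [F] at the single point [z0]; the Lipschitz condition and the diameter of
   [Lambda] extend the bound to [Lambda]. *)
have [MF HMF] : exists MF, forall t u, Lambda u -> vnorm (F t u) <= MF.
  have [||M HM] := @periodic_bounded m (F^~ z0) T HT.
  - by move=> t; apply: HFper.
  - move=> t e e0; have [d [d0 Hd]] := HFcont t z0 e e0; exists d => // t' Ht'.
    by apply: Hd => //; rewrite (_ : vsub z0 z0 = vzero m) ?vnorm0 //; vec_ring.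
  exists (M + L_F * (2 * ML)) => t u Lu.
  have := vnorm_le_sub (F t u) (F t z0); have := HM t; have := HA4F t u z0 Lu Lz0.
  have := Rmult_le_compat_l _ _ _ (Rlt_le _ _ HLF) (diam _ _ Lu Lz0); lra.
have MF0 : 0 <= MF by have := HMF 0 _ Lz0; have := vnorm_ge0 (F 0 z0); lra.
(* This common Lipschitz constant is the source of the equicontinuity. *)
have xlip x s t : inA F x -> s <= t -> vnorm (vsub (x t) (x s)) <= MF * (t - s).
  move=> Ax st; apply: (@lipschitz_closed _ x (fun t => F t (x t))) => // u _.
  by split; [apply: Ax.1|apply: HMF; apply: HLamA].
set Mg := vnorm (g z0) + L_2 * (2 * ML).
have HMg u : Lambda u -> vnorm (g u) <= Mg.
  move=> Lu; have [_ g2] := HA4g u z0 Lu Lz0.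
  have := vnorm_le_sub (g u) (g z0); rewrite /Mg.
  have := Rmult_le_compat_l _ _ _ (Rlt_le _ _ HL2) (diam _ _ Lu Lz0); lra.
have Mg0 : 0 <= Mg by have := HMg _ Lz0; have := vnorm_ge0 (g z0); lra.
have [C [kap [C0 [kap0 comp]]]] :=
  lin_imp_estimate HT Hp Hth_incr Hth_per HU HN Homega HUbound HLf HLW HA6.
(* Let the initial time [t - S] tend to [-oo] in the estimate on [[t - S, t]]. *)
set Mphi := C * (M_f + Mg + M_W).
have HMphi x t : inA F x -> vnorm (phi x t) <= Mphi.
  move=> Ax; have [/imp_sol_lin sol [M HM]] := Hphi x Ax.
  apply: le_epsilon => e e0.
  have M0 : 0 <= M by have := HM 0; have := vnorm_ge0 (phi x 0); lra.
  have CM : 0 < C * (M + 1) by apply: Rmult_lt_0_compat; lra.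
  have [S S0 HS] := exp_small kap0 (Rdiv_lt_0_compat _ _ e0 CM).
  have := comp _ _ _ (t - S) t (M + 1) (M_f + Mg + M_W) sol ltac:(lra) ltac:(lra) ltac:(lra).
  have -> : t - (t - S) = S by ring.
  move=> H; apply: Rle_trans (H _ _) _.
  - by have := HM (t - S); lra.
  - move=> u _; have := vnorm_add (f u (phi x u)) (g (x u)).
    have := HA3f u (phi x u); have := HA3W (phi x u); have := HMg _ (HLamA x Ax u).
    have := Rmult_le_pos _ _ (Rlt_le _ _ HLf) (vnorm_ge0 (phi x u)).
    have := Rmult_le_pos _ _ (Rlt_le _ _ HLW) (vnorm_ge0 (phi x u)); lra.
  - have := Rmult_le_compat_l _ _ _ (Rlt_le _ _ CM) HS.
    have -> : C * (M + 1) * (e / (C * (M + 1))) = e by field; lra.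
    by rewrite /Mphi; lra.
have Mphi0 : 0 <= Mphi by have := HMphi x0 0 Ax0; have := vnorm_ge0 (phi x0 0); lra.
(* Only constants that do not depend on [x] and [delta1] are chosen up to [exists (eps / 2), Db]. *)
have [aA aA0 HaA] := mv_bound A.
have [gap gap0 Hgap] := impulse_gap Hp Hth_incr Hth_per.
set H := L_1 * eps0; have H0 : 0 < H by apply: Rmult_lt_0_compat.
set Kh := 2 * L_2 * MF.
have Kh0 : 0 <= Kh by apply: Rmult_le_pos; lra.
(* The three bounds make the window fit into [J], keep it shorter than the gap between impulses, and
   keep the variation of the forcing below [H / 2]. *)
set tau3 := Rmin (Delta / 2) (Rmin (gap / 2) (H / (2 * (Kh + 1)))).
have q0 : 0 < H / (2 * (Kh + 1)) by apply: Rdiv_lt_0_compat; lra.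
have tau30 : 0 < tau3 by apply: Rmin_pos; [lra|apply: Rmin_pos; lra].
have tD : tau3 <= Delta / 2 by apply: Rmin_l.
have tR : tau3 <= Rmin (gap / 2) (H / (2 * (Kh + 1))) by apply: Rmin_r.
have tg := Rle_trans _ _ _ tR (Rmin_l _ _).
have tH := Rle_trans _ _ _ tR (Rmin_r _ _).
set tau := tau3 / 3; have tau0 : 0 < tau by rewrite /tau; lra.
set K := aA + L_f; have K0 : 0 <= K by rewrite /K; lra.
have KhT : Kh * tau <= H / 2.
  have : (Kh + 1) * tau3 <= H / 2.
    have -> : H / 2 = (Kh + 1) * (H / (2 * (Kh + 1))) by field; lra.
    by apply: Rmult_le_compat_l; lra.
  rewrite /tau; nra.
have tK0 : 0 <= tau * K by apply: Rmult_le_pos; lra.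
set eps := tau * H / (4 * (2 + tau * K)).
have tH0 : 0 < tau * H by apply: Rmult_lt_0_compat.
have eps_0 : 0 < eps by apply: Rdiv_lt_0_compat; lra.
have Heps : (2 + tau * K) * eps < tau * (H / 2).
  have -> : (2 + tau * K) * eps = tau * H / 4 by rewrite /eps; field; lra.
  lra.
set D := K * (2 * Mphi) + L_2 * (2 * ML) + 1.
have D0 : 0 < D.
  have := Rmult_le_pos _ _ K0 Mphi0; have := Rmult_le_pos _ _ (Rlt_le _ _ HL2) ML0.
  by rewrite /D; lra.
(* Within time [Db] the difference, Lipschitz with constant [D] off the impulses, changes by at most
   [eps / 2]. *)
set Db := Rmin (tau / 2) (eps / (2 * D)).
have Db0 : 0 < Db by apply: Rmin_pos; [lra|apply: Rdiv_lt_0_compat; lra].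
have Dbt : Db <= tau / 2 by apply: Rmin_l.
have DbD : D * Db <= eps / 2.
  have -> : eps / 2 = D * (eps / (2 * D)) by field; lra.
  by apply: Rmult_le_compat_l; [lra|apply: Rmin_r].
exists (eps / 2), Db; split; first lra; split=> // delta1 delta10 x Ax.
set r := 2 * Mphi + 1; have r0 : 0 < r by rewrite /r; lra.
have Cr0 : 0 < C * r by apply: Rmult_lt_0_compat.
(* Looking back over time [S], the remembered data contribute at most [delta1 / 4] at [t0]. *)
have [S S0 HS] : exists2 S, 0 <= S & exp (- kap * S) <= delta1 / 4 / (C * r).
  by apply: exp_small => //; apply: Rdiv_lt_0_compat; lra.
have ES := exp_pos (L_F * S).
have CE0 : 0 < C * (L_2 * exp (L_F * S)) by repeat apply: Rmult_lt_0_compat => //.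
(* Closeness [delta0] at [t0], after backward growth by [exp (L_F * S)] and the factor [C * L_2],
   contributes another [delta1 / 4]. *)
set delta0 := delta1 / 4 / (C * (L_2 * exp (L_F * S))).
have delta00 : 0 < delta0 by apply: Rdiv_lt_0_compat; lra.
have [xb [t0 [J [Axb [Jint [Jt0 [Jlen [close far]]]]]]]] := sens delta0 delta00 x Ax.
have [sol _] := Hphi x Ax; have [solb _] := Hphi xb Axb.
have dsol := lin_imp_sub (imp_sol_lin sol) (imp_sol_lin solb).
set d := fun t => vsub (phi x t) (phi xb t).
rewrite -/d in dsol.
have dM t : vnorm (d t) <= 2 * Mphi.
  by have := vnorm_sub (phi x t) (phi xb t); have := HMphi x t Ax; have := HMphi xb t Axb; rewrite /d; lra.
have Lx t : Lambda (x t) by apply: HLamA.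
have Lxb t : Lambda (xb t) by apply: HLamA.
pose h t := vsub (g (x t)) (g (xb t)).
pose l t := vadd (mv A (d t)) (vsub (f t (phi x t)) (f t (phi xb t))).
have lK t : vnorm (l t) <= K * vnorm (d t).
  apply: Rle_trans (vnorm_add _ _) _; have := HaA (d t); have := HA4f t (phi x t) (phi xb t).
  by rewrite -/(d t) /K; lra.
have hM t : vnorm (h t) <= L_2 * (2 * ML).
  have [_ g2] := HA4g (x t) (xb t) (Lx t) (Lxb t).
  by have := Rmult_le_compat_l _ _ _ (Rlt_le _ _ HL2) (diam _ _ (Lx t) (Lxb t)); rewrite /h; lra.
have dD t : (forall k, t <> theta k) -> has_deriv d t (vadd (l t) (h t)).
  move=> nt; have := dsol.2.1 t nt.
  by rewrite /= (_ : vadd _ (vsub _ _) = vadd (l t) (h t)) // /l /h; vec_ring.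
have back u : t0 - S <= u <= t0 -> vnorm (vsub (x u) (xb u)) <= delta0 * exp (L_F * S).
  move=> Hu.
  have [t _|_ G] := @gronwall _ (fun t => vsub (x t) (xb t))
    (fun t => vsub (F t (x t)) (F t (xb t))) L_F u t0 ltac:(lra).
    split; last exact: HA4F.
    by apply: has_deriv_sub; [apply: Ax.1|apply: Axb.1].
  apply: Rle_trans G _; apply: Rmult_le_compat; [exact: vnorm_ge0|exact: Rlt_le (exp_pos _)|lra|].
  have [lt|->] : L_F * (t0 - u) < L_F * S \/ L_F * (t0 - u) = L_F * S.
  - have := Rmult_le_compat_l L_F (t0 - u) S ltac:(lra) ltac:(lra); lra.
  - exact: Rlt_le (exp_increasing _ _ lt).
  - lra.
have dt0 : vnorm (d t0) < delta1.
  have eta0 : 0 <= L_2 * (delta0 * exp (L_F * S)).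
    by apply: Rmult_le_pos; [lra|apply: Rmult_le_pos; lra].
  have := comp _ _ _ (t0 - S) t0 r (L_2 * (delta0 * exp (L_F * S))) dsol
    ltac:(lra) r0 eta0.
  have -> : t0 - (t0 - S) = S by ring.
  move=> Hc; apply: Rle_lt_trans (Hc _ _) _.
  - by have := dM (t0 - S); rewrite /r; lra.
  - move=> u Hu.
    have g2 := (HA4g (x u) (xb u) (Lx u) (Lxb u)).2.
    have g3 := Rmult_le_compat_l _ _ _ (Rlt_le _ _ HL2) (back u Hu).
    split; last by have := HA4W (phi x u) (phi xb u); rewrite /d; lra.
    rewrite (_ : vsub (vadd _ _) _ = vadd (vsub (f u (phi x u)) (f u (phi xb u))) (h u));
      last by rewrite /h; vec_ring.
    have := vnorm_add (vsub (f u (phi x u)) (f u (phi xb u))) (h u).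
    have := HA4f u (phi x u) (phi xb u); rewrite /d /h; lra.
  - have e1 := Rmult_le_compat_l _ _ _ (Rlt_le _ _ Cr0) HS.
    have e2 : C * r * (delta1 / 4 / (C * r)) = delta1 / 4 by field; lra.
    have e3 : C * (L_2 * (delta0 * exp (L_F * S))) = delta1 / 4.
      by rewrite /delta0; field; lra.
    by rewrite Rmult_plus_distr_l e3; lra.
(* [length_ge] provides only points nearly [Delta] apart; a distance above [Delta / 2] leaves room
   for [tau3]. *)
have [u [v [Ju [Jv uv]]]] := Jlen (Delta / 2) ltac:(lra).
have [a [ua [av free]]] := @impulse_free_interval theta gap u tau3 Hth_incr Hgap ltac:(lra).
rewrite -/tau in av free.
have inJ t : a <= t <= a + tau -> J t by move=> Ht; apply: (Jint u t v) => //; lra.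
have [t Ht||ts Hts big] := @forced_excursion _ d l h K Kh H tau a eps H0 K0 tau0 KhT eps_0 Heps.
- split; first exact: dD (free t Ht).
  split; first exact: lK.
  have gx := (HA4g (x t) (x a) (Lx t) (Lx a)).2.
  have gxb := (HA4g (xb a) (xb t) (Lxb a) (Lxb t)).2.
  have l1 := xlip x a t Ax (proj1 Ht).
  have l2 := xlip xb a t Axb (proj1 Ht).
  rewrite vnorm_subC in l2.
  have := vnorm_add (vsub (g (x t)) (g (x a))) (vsub (g (xb a)) (g (xb t))).
  rewrite (_ : vadd _ _ = vsub (h t) (h a)); last by rewrite /h; vec_ring.
  have := Rmult_le_compat_l _ _ _ (Rlt_le _ _ HL2) l1.
  have := Rmult_le_compat_l _ _ _ (Rlt_le _ _ HL2) l2.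
  by rewrite /Kh; lra.
- have [g1 _] := HA4g (x a) (xb a) (Lx a) (Lxb a).
  have := far a (inJ a ltac:(lra)) => /Rlt_le fa.
  by have := Rmult_le_compat_l _ _ _ (Rlt_le _ _ HL1) fa; rewrite /h /H; lra.
have lip s t : a <= s <= t -> t <= a + tau -> vnorm (vsub (d t) (d s)) <= D * (t - s).
  move=> Hs Ht; apply: (@lipschitz_closed _ d (fun t => vadd (l t) (h t))); first lra.
  move=> w Hw; split; first by apply: dD; apply: free; lra.
  have := vnorm_add (l w) (h w); have := lK w; have := hM w.
  by have := Rmult_le_compat_l _ _ _ K0 (dM w); rewrite /D; lra.
(* The final interval starts or ends at the excursion time [ts], whichever keeps it inside the
   impulse-free window. *)
have [a1 [aa1 [a1b a1ts]]] : exists a1, a <= a1 /\ a1 + Db <= a + tau /\ a1 <= ts <= a1 + Db.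
  case: (Rle_or_lt (ts + Db) (a + tau)) => c; first by exists ts; lra.
  by exists (ts - Db); lra.
have J1J t : a1 <= t <= a1 + Db -> a <= t <= a + tau by lra.
exists xb, t0, (fun t => a1 <= t <= a1 + Db); split=> //.
split; first by move=> u' v' w'; lra.
split; first by move=> t Ht; apply: Jt0; apply: inJ; lra.
split; first by move=> e e0; exists a1, (a1 + Db); lra.
split; first by move=> k1 k2 Hk; case: (free (theta k1) (J1J _ Hk) k1).
split=> // t Ht; rewrite -/(d t).
have near : vnorm (vsub (d ts) (d t)) <= D * Db.
  case: (Rle_or_lt t ts) => c.
    apply: Rle_trans (lip t ts _ _) _; [lra|lra|].
    by apply: Rmult_le_compat_l; lra.
  rewrite vnorm_subC; apply: Rle_trans (lip ts t _ _) _; [lra|lra|].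
  by apply: Rmult_le_compat_l; lra.
have := vnorm_le_sub (d ts) (d t); lra.
Qed.
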